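(* For each $t \in \mathbb{Z}[\frac12]$ with $t>-1$ and all $G,H \in \widetilde{\mathbb{G}}$, $$(G+H)_t=G_t+H_t$$ holds (as an equality of game values).
   Context: Games. $\widetilde{\mathbb{G}}$ is the set of all formal (short, i.e. finite loopfree) normal-play partizan games $G=\{G^L\mid G^R\}$, where $G^L$ (resp. $G^R$) ranges over the finitely many Left (resp. Right) options of $G$; $\tilde b(G)$ is the formal birthday (height of the game tree). Sums and negatives of games are the usual ones; $G\ge 0$ means Left wins $G$ moving second under normal play, $G\ge H$ means $G-H\ge 0$, and $G$ is equal to $H$ (equality of game values) if $G\ge H$ and $H\ge G$. The dyadic rationals $\mathbb{Z}[\frac12]$ are identified in the usual way with the numbers among game values; ''equal to an integer/number'' means having such a game value. When a dyadic rational is used as a formal game, its canonical form is meant. Cooling and temperature. For $G\in\widetilde{\mathbb{G}}$ and $t\in\mathbb{Z}[\frac12]$, define $\lambda_t(G),\rho_t(G)\in\mathbb{Z}[\frac12]$, $G_t\in\widetilde{\mathbb{G}}$ and $t(G)\in\mathbb{Z}[\frac12]\cup\{-\infty\}$ by recursion on $\tilde b(G)$ (this recursion is well-defined): - If $G$ is equal to an integer $n$: $\lambda_t(G)=\rho_t(G)=n$, $G_t=n$ (canonical form), $t(G)=-\infty$. - Otherwise let $\widetilde{\lambda}_t(G)=\max_{G^L}\{\rho_t(G^L)-t\}$, $\widetilde{\rho}_t(G)=\min_{G^R}\{\lambda_t(G^R)+t\}$, $\widetilde{G}_t=\{(G^L)_t-t\mid (G^R)_t+t\}$ (with all $G^L$,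 $G^R$), and $t(G)=\min\{t\in\mathbb{Z}[\frac12]\mid \widetilde{\lambda}_t(G)=\widetilde{\rho}_t(G)\}$. If $t\le t(G)$, set $\lambda_t(G)=\widetilde{\lambda}_t(G)$, $\rho_t(G)=\widetilde{\rho}_t(G)$, $G_t=\widetilde{G}_t$. If $t>t(G)$, set $\lambda_t(G)=\rho_t(G)=x$ and $G_t=x$ (canonical form), where $x=\lambda_{t(G)}(G)=\rho_{t(G)}(G)$. *)

(* Defs.v *)
From HB Require Import structures.
From mathcomp Require Import all_boot all_order all_algebra.
From mathcomp Require Import boolp classical_sets constructive_ereal.

Set Implicit Arguments.
Unset Strict Implicit.
Unset Printing Implicit Defensive.

Import Order.TTheory GRing.Theory Num.Theory.
Local Open Scope ring_scope.

(** Short games, given by finite lists of options. Order and repetitions in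
    these lists are immaterial for every notion below. *)
Inductive game := Game of seq game & seq game.

Declare Scope game_scope.
Delimit Scope game_scope with game.
Bind Scope game_scope with game.

Definition left_options (G : game) := let: Game GL _ := G in GL.
Definition right_options (G : game) := let: Game _ GR := G in GR.

Fixpoint game_opp (G : game) : game :=
  let: Game GL GR := G in Game (map game_opp GR) (map game_opp GL).

Fixpoint game_add (G : game) : game -> game :=
  let: Game GL GR := G in
  fix addG (H : game) : game :=
    let: Game HL HR := H in
    Game ([seq game_add g H | g <- GL] ++ [seq addG h | h <- HL])
         ([seq game_add g H | g <- GR] ++ [seq addG h | h <- HR]).

Notation "G + H" := (game_add G H) : game_scope.
Notation "- G" := (game_opp G) : game_scope.
Notation "G - H" := (game_add G (game_opp H)) : game_scope.

(** [left_wins b G]: under normal play Left wins [G] when Left ([b = true]) or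
    Right ([b = false]) moves first. *)
Fixpoint left_wins (left_first : bool) (G : game) : bool :=
  let: Game GL GR := G in
  if left_first then has (left_wins false) GL else all (left_wins true) GR.

Definition game_ge0 (G : game) : bool := left_wins false G.
Definition game_ge (G H : game) : bool := game_ge0 (G - H)%game.
Definition game_eqv (G H : game) : bool := game_ge G H && game_ge H G.

Notation "G =v H" := (game_eqv G H) (at level 70) : game_scope.

Definition is_dyadic (x : rat) : Prop :=
  exists (m : int) (k : nat), x = m%:~R / 2%:R ^+ k.

Fixpoint nat_game (n : nat) : game :=
  if n is m.+1 then Game [:: nat_game m] [::] else Game [::] [::].

Definition int_game (n : int) : game :=
  match n with
  | Posz m => nat_game m
  | Negz m => game_opp (nat_game m.+1)
  end.

(** Canonical form of [m / 2 ^ k]: for odd [m] and [k > 0] it is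
    [{(m - 1) / 2 ^ k | (m + 1) / 2 ^ k}]. *)
Fixpoint dyadic_game (k : nat) (m : int) : game :=
  if k is j.+1 then
    let q := (m %/ 2)%Z in
    if (2 %| m)%Z then dyadic_game j q
    else Game [:: dyadic_game j q] [:: dyadic_game j (q + 1)]
  else int_game m.

(** Canonical form of a dyadic rational (meaningless for other rationals). *)
Definition num_game (x : rat) : game :=
  dyadic_game (logn 2 `|denq x|) (numq x).

Definition int_value (G : game) : option int :=
  if pselect (exists n : int, (G =v int_game n)%game) is left ex
  then Some (xchoose ex) else None.

(** Maximum and minimum of a nonempty sequence. A game that is not equal to an
    integer has both Left and Right options, so the value at [[::]] plays no
    role below. *)
Definition seq_max (s : seq rat) : rat := \big[Num.max/head 0 s]_(x <- s) x.
Definition seq_min (s : seq rat) : rat := \big[Num.min/head 0 s]_(x <- s) x.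

(** Minimum of a set of rationals (0 if there is none). *)
Definition set_min (A : set rat) : rat :=
  xget 0 [set t | A t /\ forall u, A u -> t <= u].

Record thermo := Thermo {
  thermo_lambda : rat -> rat;
  thermo_rho : rat -> rat;
  thermo_cool : rat -> game;
  thermo_temp : \bar rat }.

(** The simultaneous recursion defining the stops, the cooled games and the
    temperature. The minimum [tG] exists whenever [G] is not equal to an
    integer: by induction the difference [l - r] is continuous, piecewise linear
    with dyadic breakpoints and slopes in [{0, -1, -2}], it is negative for
    large [t], and positive at [t = -1]. *)
Fixpoint thermograph (G : game) : thermo :=
  let: Game GL GR := G in
  if int_value G is Some n then
    Thermo (fun=> n%:~R) (fun=> n%:~R) (fun=> int_game n) -oo%E
  else
    let l t := seq_max [seq thermo_rho (thermograph g) t - t | g <- GL] in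
    let r t := seq_min [seq thermo_lambda (thermograph g) t + t | g <- GR] in
    let c t :=
      Game [seq (thermo_cool (thermograph g) t - num_game t)%game | g <- GL]
           [seq (thermo_cool (thermograph g) t + num_game t)%game | g <- GR] in
    let tG := set_min [set t | is_dyadic t /\ l t = r t] in
    let x := l tG in
    Thermo (fun t => if t <= tG then l t else x)
           (fun t => if t <= tG then r t else x)
           (fun t => if t <= tG then c t else num_game x)
           tG%:E.

Definition stop_left (t : rat) (G : game) : rat :=
  thermo_lambda (thermograph G) t.
Definition stop_right (t : rat) (G : game) : rat :=
  thermo_rho (thermograph G) t.
Definition cool (t : rat) (G : game) : game := thermo_cool (thermograph G) t.
Definition temperature (G : game) : \bar rat := thermo_temp (thermograph G).

(* Main.v *)
Require Import Defs.
From HB Require Import structures.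
From mathcomp Require Import all_boot all_order all_algebra.
From mathcomp Require Import boolp classical_sets constructive_ereal.
From mathcomp Require Import generic_quotient zify ring lra.

Set Implicit Arguments.
Unset Strict Implicit.
Unset Printing Implicit Defensive.

Import Order.TTheory GRing.Theory Num.Theory.
Local Open Scope ring_scope.

(** Why arbitrary lists of summands: the cooled form of [G + H] is not assembled from those of [G]
    and [H], since the three games may freeze at different temperatures. With the negative of
    [G + H] as one more summand, the claim becomes an inequality between sums whose shape survives
    every move, so it can be proved by induction on total size. The order on values is partial, and
    stops see a cooled game only up to an infinitesimal. Estimates are therefore comparisons with
    dyadic numbers, strict where an infinitesimal could matter, and failures of [<=] are kept as
    negations. A separate burden is the minimum that defines the temperature. It exists because, on
    a fine enough dyadic mesh, every wall is affine on each cell, with integral slope and with a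
    multiple of the mesh as its height at the left end. Maxima, taxes and freezing preserve this
    shape. It is proved together with the behaviour at -1, which guarantees that the walls of a
    non-integer start out crossed. *)

(** Cooling is monotone on sums: if [G_1 + ... + G_n >= 0], then the sum of the
    cooled summands is [>= 0]. Applied to [G], [H], [-(G + H)] and to their
    negatives this is additivity. Left defends the cooled sum by copying the
    winning strategy of the original one: every exchange of moves costs each
    player [t], so only two points need care. First, Left's reply may fall in a
    frozen summand [x]; there [x + t] is still not below the cooled Left option,
    because that option's right stop minus the tax had come down to [x] before
    temperature [t]. Second, Right may move in a frozen summand; such a move in
    a number is never needed, since an unfrozen cooled game, and hence a sum of
    such games (Milnor), has its left wall at or above its right wall. When all
    summands are frozen, one lowers the temperature until one of them thaws.
    Integers behave like games frozen at temperature [-1], where the stops of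
    [G] are its integer ceiling and floor: this is where [t > -1] is used. *)

(** * Order and sums of games *)

HB.instance Definition _ := gen_eqMixin game.
HB.instance Definition _ := gen_choiceMixin game.

Local Notation zero_game := (Game [::] [::]).

Fixpoint game_size (G : game) : nat :=
  let: Game GL GR := G in
  (sumn (map game_size GL) + sumn (map game_size GR)).+1.

Lemma mem_leq_sumn (T : eqType) (f : T -> nat) (s : seq T) x :
  x \in s -> (f x <= sumn (map f s))%N.
Proof.
elim: s => //= y s IH; rewrite inE => /predU1P[->|/IH]; first exact: leq_addr.
by move/leq_trans; apply; rewrite leq_addl.
Qed.

Lemma left_option_size G l :
  l \in left_options G -> (game_size l < game_size G)%N.
Proof.
by case: G => GL GR /= /(mem_leq_sumn game_size)/leq_trans; apply; exact: leq_addr.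
Qed.

Lemma right_option_size G r :
  r \in right_options G -> (game_size r < game_size G)%N.
Proof.
by case: G => GL GR /= /(mem_leq_sumn game_size)/leq_trans; apply; exact: leq_addl.
Qed.

(** Options sit inside lists, so induction on positions goes through [game_size]. *)
Lemma game_option_ind (P : game -> Prop) :
  (forall G, (forall l, l \in left_options G -> P l) ->
             (forall r, r \in right_options G -> P r) -> P G) ->
  forall G, P G.
Proof.
move=> step G; have [n] := ubnP (game_size G).
elim: n G => // n IH G; rewrite ltnS => szG; apply: step => x xG; apply: IH.
  exact: leq_trans (left_option_size xG) szG.
exact: leq_trans (right_option_size xG) szG.
Qed.

Lemma game_ext G H :
  left_options G = left_options H -> right_options G = right_options H -> G = H.
Proof. by case: G; case: H => ? ? ? ? /= -> ->. Qed.

Lemma left_options_opp G :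
  left_options (- G)%game = map game_opp (right_options G).
Proof. by case: G. Qed.

Lemma right_options_opp G :
  right_options (- G)%game = map game_opp (left_options G).
Proof. by case: G. Qed.

Lemma left_options_add G H : left_options (G + H)%game =
  [seq (g + H)%game | g <- left_options G] ++
  [seq (G + h)%game | h <- left_options H].
Proof. by case: G; case: H. Qed.

Lemma right_options_add G H : right_options (G + H)%game =
  [seq (g + H)%game | g <- right_options G] ++
  [seq (G + h)%game | h <- right_options H].
Proof. by case: G; case: H. Qed.

Lemma game_oppK : involutive game_opp.
Proof.
elim/game_option_ind => G IHl IHr; apply: game_ext.
  rewrite left_options_opp right_options_opp -map_comp -[RHS]map_id.
  exact/eq_in_map.
rewrite right_options_opp left_options_opp -map_comp -[RHS]map_id.
exact/eq_in_map.
Qed.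

Lemma game_oppD G H : (- (G + H))%game = (- G + - H)%game.
Proof.
have [n] := ubnP (game_size G + game_size H).
elim: n G H => // n IH G H; rewrite ltnS => sz; apply: game_ext.
  rewrite left_options_opp right_options_add left_options_add.
  rewrite !left_options_opp map_cat -!map_comp.
  congr (_ ++ _); apply/eq_in_map => r /right_option_size ltr /=;
    apply: IH; lia.
rewrite right_options_opp left_options_add right_options_add.
rewrite !right_options_opp map_cat -!map_comp.
congr (_ ++ _); apply/eq_in_map => r /left_option_size ltr /=;
  apply: IH; lia.
Qed.

Local Notation le_game G H := (game_ge H G).

Lemma left_winsE b G : left_wins b G =
  if b then has (left_wins false) (left_options G)
  else all (left_wins true) (right_options G).
Proof. by case: G. Qed.

(** Determinacy together with Conway's recursive description of the order. Unfolding one move of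
    either statement produces the other, so they share an induction; afterwards strategies are
    replaced by the recursive order. *)
Lemma left_wins_sub G H :
  (left_wins true (G - H)%game = ~~ le_game G H) /\
  (le_game H G = all (fun r => ~~ le_game r H) (right_options G) &&
                all (fun l => ~~ le_game G l) (left_options H)).
Proof.
have [n] := ubnP (game_size G + game_size H).
elim: n G H => // n IH G H; rewrite ltnS => sz.
have ge_rec A B : (game_size A + game_size B <= n)%N ->
    le_game B A = all (fun r => ~~ le_game r B) (right_options A) &&
                all (fun l => ~~ le_game A l) (left_options B).
  move=> szAB; rewrite /game_ge /game_ge0 left_winsE right_options_add.
  rewrite right_options_opp all_cat !all_map.
  congr (_ && _); apply: eq_in_all => x /=.
    by move=> /right_option_size ltx; have [-> _] := IH x B ltac:(lia).
  by move=> /left_option_size ltx; have [-> _] := IH A x ltac:(lia).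
split; last exact: ge_rec.
rewrite ge_rec; last by rewrite addnC.
rewrite left_winsE left_options_add left_options_opp has_cat !has_map.
rewrite negb_and -!has_predC orbC.
by congr (_ || _); apply: eq_has => x /=; rewrite negbK.
Qed.

Lemma le_gameP G H :
  reflect ((forall l, l \in left_options G -> ~~ le_game H l) /\
           (forall r, r \in right_options H -> ~~ le_game r G)) (le_game G H).
Proof.
have [_ ->] := left_wins_sub H G; rewrite andbC.
by apply: (iffP andP) => [] [/allP ? /allP ?].
Qed.

Lemma le_game_refl G : le_game G G.
Proof.
elim/game_option_ind: G => G IHl IHr; apply/le_gameP; split=> x xG.
  by apply/negP => /le_gameP[/(_ x xG)/negP[]]; exact: IHl.
by apply/negP => /le_gameP[_ /(_ x xG)/negP[]]; exact: IHr.
Qed.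

Lemma le_game_trans G H K : le_game G H -> le_game H K -> le_game G K.
Proof.
have [n] := ubnP (game_size G + game_size H + game_size K).
elim: n G H K => // n IH G H K; rewrite ltnS => sz leGH leHK.
apply/le_gameP; split=> x xG; apply/negP => lex.
  have leHx : le_game H x.
    by apply: IH leHK lex; have := left_option_size xG; lia.
  by move/le_gameP: leGH => [/(_ x xG)/negP[]].
have lexH : le_game x H.
  by apply: IH lex leGH; have := right_option_size xG; lia.
by move/le_gameP: leHK => [_ /(_ x xG)/negP[]].
Qed.

Lemma mem_left_addl G H l :
  l \in left_options G -> (l + H)%game \in left_options (G + H).
Proof. move=> lG; rewrite left_options_add mem_cat; apply/orP; left.
by apply/mapP; eexists; first exact: lG. Qed.

Lemma mem_left_addr G H l :
  l \in left_options H -> (G + l)%game \in left_options (G + H).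
Proof. move=> lH; rewrite left_options_add mem_cat; apply/orP; right.
by apply/mapP; eexists; first exact: lH. Qed.

Lemma mem_right_addl G H r :
  r \in right_options G -> (r + H)%game \in right_options (G + H).
Proof. move=> rG; rewrite right_options_add mem_cat; apply/orP; left.
by apply/mapP; eexists; first exact: rG. Qed.

Lemma mem_right_addr G H r :
  r \in right_options H -> (G + r)%game \in right_options (G + H).
Proof. move=> rH; rewrite right_options_add mem_cat; apply/orP; right.
by apply/mapP; eexists; first exact: rH. Qed.

Lemma mem_left_add G H x : x \in left_options (G + H) ->
  (exists2 l, l \in left_options G & x = (l + H)%game) \/
  (exists2 l, l \in left_options H & x = (G + l)%game).
Proof.
by rewrite left_options_add mem_cat => /orP[] /mapP[l lG ->]; [left|right];
  exists l.
Qed.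

Lemma mem_right_add G H x : x \in right_options (G + H) ->
  (exists2 r, r \in right_options G & x = (r + H)%game) \/
  (exists2 r, r \in right_options H & x = (G + r)%game).
Proof.
by rewrite right_options_add mem_cat => /orP[] /mapP[l lG ->]; [left|right];
  exists l.
Qed.

Lemma left_option_nge G l : l \in left_options G -> ~~ le_game G l.
Proof.
move=> lG; apply/negP => /le_gameP[/(_ l lG)/negP[]]; exact: le_game_refl.
Qed.

Lemma right_option_nle G r : r \in right_options G -> ~~ le_game r G.
Proof.
move=> rG; apply/negP => /le_gameP[_ /(_ r rG)/negP[]]; exact: le_game_refl.
Qed.

(** Monotonicity and cancellation need each other on smaller triples: a move in [G] or [H] is
    settled by the opposite direction, a move in [K] by monotonicity. *)
Lemma le_game_add2r K G H : le_game (G + K)%game (H + K)%game = le_game G H.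
Proof.
have [n] := ubnP (game_size G + game_size H + game_size K).
elim: n G H K => // n IH G H K; rewrite ltnS => sz.
apply/idP/idP => leGH.
  apply/le_gameP; split=> x xG; apply/negP => lex.
    have /negP[] := left_option_nge (mem_left_addl K xG).
    apply: le_game_trans leGH _; rewrite IH //.
    by have := left_option_size xG; lia.
  have /negP[] := right_option_nle (mem_right_addl K xG).
  apply: le_game_trans leGH; rewrite IH //.
  by have := right_option_size xG; lia.
apply/le_gameP; split=> x; [case/mem_left_add|case/mem_right_add] => -[y yG ->];
  apply/negP.
- rewrite IH; last by have := left_option_size yG; lia.
  by move: leGH => /le_gameP[/(_ y yG)/negP].
- move=> lex; have /negP[] := left_option_nge (mem_left_addr H yG).
  apply: le_game_trans lex _; rewrite IH //.
  by have := left_option_size yG; lia.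
- rewrite IH; last by have := right_option_size yG; lia.
  by move: leGH => /le_gameP[_ /(_ y yG)/negP].
- move=> lex; have /negP[] := right_option_nle (mem_right_addr G yG).
  apply: le_game_trans lex; rewrite IH //.
  by have := right_option_size yG; lia.
Qed.

Lemma le_game_addC G H : le_game (G + H)%game (H + G)%game.
Proof.
have [n] := ubnP (game_size G + game_size H).
elim: n G H => // n IH G H; rewrite ltnS => sz.
apply/le_gameP; split=> x; [case/mem_left_add|case/mem_right_add] => -[y yG ->];
  apply/negP => lex.
- have /negP[] := left_option_nge (mem_left_addr H yG).
  by apply: le_game_trans lex (IH _ _ _); have := left_option_size yG; lia.
- have /negP[] := left_option_nge (mem_left_addl G yG).
  by apply: le_game_trans lex (IH _ _ _); have := left_option_size yG; lia.
- have /negP[] := right_option_nle (mem_right_addr G yG).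
  by apply: le_game_trans (IH _ _ _) lex; have := right_option_size yG; lia.
- have /negP[] := right_option_nle (mem_right_addl H yG).
  by apply: le_game_trans (IH _ _ _) lex; have := right_option_size yG; lia.
Qed.

Lemma le_game_addA G H K :
  le_game (G + (H + K))%game (G + H + K)%game /\
  le_game (G + H + K)%game (G + (H + K))%game.
Proof.
have [n] := ubnP (game_size G + game_size H + game_size K).
elim: n G H K => // n IH G H K; rewrite ltnS => sz.
have IHl x y z : (game_size x + game_size y + game_size z < n)%N ->
  le_game (x + (y + z))%game (x + y + z)%game by move=> /IH[].
have IHr x y z : (game_size x + game_size y + game_size z < n)%N ->
  le_game (x + y + z)%game (x + (y + z))%game by move=> /IH[].
split; apply/le_gameP; split=> x.
- case/mem_left_add=> [[y yG ->]|[_ /mem_left_add[[y yG ->]|[y yG ->]] ->]];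
    have := left_option_size yG => szy; apply/negP => lex.
  + have /negP[] := left_option_nge (mem_left_addl K (mem_left_addl H yG)).
    by apply: le_game_trans lex (IHl _ _ _ _); lia.
  + have /negP[] := left_option_nge (mem_left_addl K (mem_left_addr G yG)).
    by apply: le_game_trans lex (IHl _ _ _ _); lia.
  + have /negP[] := left_option_nge (mem_left_addr (G + H)%game yG).
    by apply: le_game_trans lex (IHl _ _ _ _); lia.
- case/mem_right_add=> [[_ /mem_right_add[[y yG ->]|[y yG ->]] ->]|[y yG ->]];
    have := right_option_size yG => szy; apply/negP => lex.
  + have /negP[] := right_option_nle (mem_right_addl (H + K)%game yG).
    by apply: le_game_trans (IHl _ _ _ _) lex; lia.
  + have /negP[] := right_option_nle (mem_right_addr G (mem_right_addl K yG)).
    by apply: le_game_trans (IHl _ _ _ _) lex; lia.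
  + have /negP[] := right_option_nle (mem_right_addr G (mem_right_addr H yG)).
    by apply: le_game_trans (IHl _ _ _ _) lex; lia.
- case/mem_left_add=> [[_ /mem_left_add[[y yG ->]|[y yG ->]] ->]|[y yG ->]];
    have := left_option_size yG => szy; apply/negP => lex.
  + have /negP[] := left_option_nge (mem_left_addl (H + K)%game yG).
    by apply: le_game_trans lex (IHr _ _ _ _); lia.
  + have /negP[] := left_option_nge (mem_left_addr G (mem_left_addl K yG)).
    by apply: le_game_trans lex (IHr _ _ _ _); lia.
  + have /negP[] := left_option_nge (mem_left_addr G (mem_left_addr H yG)).
    by apply: le_game_trans lex (IHr _ _ _ _); lia.
- case/mem_right_add=> [[y yG ->]|[_ /mem_right_add[[y yG ->]|[y yG ->]] ->]];
    have := right_option_size yG => szy; apply/negP => lex.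
  + have /negP[] := right_option_nle (mem_right_addl K (mem_right_addl H yG)).
    by apply: le_game_trans (IHr _ _ _ _) lex; lia.
  + have /negP[] := right_option_nle (mem_right_addl K (mem_right_addr G yG)).
    by apply: le_game_trans (IHr _ _ _ _) lex; lia.
  + have /negP[] := right_option_nle (mem_right_addr (G + H)%game yG).
    by apply: le_game_trans (IHr _ _ _ _) lex; lia.
Qed.

Lemma game_add0 G : (G + zero_game)%game = G.
Proof.
elim/game_option_ind: G => G IHl IHr; apply: game_ext.
  rewrite left_options_add /= cats0 -[RHS]map_id; exact/eq_in_map.
rewrite right_options_add /= cats0 -[RHS]map_id; exact/eq_in_map.
Qed.

Lemma le_game0 G : le_game zero_game G = game_ge0 G.
Proof. by rewrite /game_ge /= game_add0. Qed.

Lemma game_eqv_refl : reflexive game_eqv.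
Proof. by move=> G; rewrite /game_eqv le_game_refl. Qed.

Lemma game_eqv_sym : symmetric game_eqv.
Proof. by move=> G H; rewrite /game_eqv andbC. Qed.

Lemma game_eqv_trans : transitive game_eqv.
Proof.
move=> H G K /andP[le1 le2] /andP[le3 le4].
by rewrite /game_eqv (le_game_trans le3 le1) (le_game_trans le2 le4).
Qed.

Canonical game_eqv_equiv :=
  EquivRel game_eqv game_eqv_refl game_eqv_sym game_eqv_trans.

(** In the quotient [=v] becomes equality and games form an ordered abelian group, so that sums over
    lists can be reordered, split and cancelled. *)
Definition game_value := {eq_quot game_eqv}%qT.
HB.instance Definition _ : EqQuotient _ game_eqv game_value :=
  EqQuotient.on game_value.
HB.instance Definition _ := Choice.on game_value.

Definition val_of (G : game) : game_value := (\pi G)%qT.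

Lemma val_ofP G H : reflect (val_of G = val_of H) (G =v H)%game.
Proof. by apply: (iffP idP) => [/eqmodP|/eqmodP]. Qed.

(** * The group of game values *)

Lemma repr_val_of G : (repr (val_of G) =v G)%game.
Proof. by apply/val_ofP; exact: reprK. Qed.

Definition value_add (x y : game_value) := val_of (repr x + repr y)%game.
Definition value_opp (x : game_value) := val_of (- repr x)%game.
Definition value_le (x y : game_value) := game_ge (repr y) (repr x).

Lemma value_leE G H : value_le (val_of G) (val_of H) = game_ge H G.
Proof.
have /andP[le1 le2] := repr_val_of G; have /andP[le3 le4] := repr_val_of H.
apply/idP/idP => leGH.
  exact: le_game_trans le1 (le_game_trans leGH le4).
exact: le_game_trans le2 (le_game_trans leGH le3).
Qed.

Lemma le_game_add2l K G H : game_ge (K + H) (K + G) = game_ge H G.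
Proof.
rewrite -(le_game_add2r K G H); apply/idP/idP => leGH.
  apply: le_game_trans (le_game_addC G K) _.
  exact: le_game_trans leGH (le_game_addC K H).
apply: le_game_trans (le_game_addC K G) _.
exact: le_game_trans leGH (le_game_addC H K).
Qed.

Lemma value_addE G H : value_add (val_of G) (val_of H) = val_of (G + H).
Proof.
apply/val_ofP; have /andP[le1 le2] := repr_val_of G.
have /andP[le3 le4] := repr_val_of H; apply/andP; split.
  by apply: (@le_game_trans _ (repr (val_of G) + H)%game);
    rewrite (le_game_add2r, le_game_add2l).
by apply: (@le_game_trans _ (repr (val_of G) + H)%game);
  rewrite (le_game_add2r, le_game_add2l).
Qed.

Lemma game_ge_opp G H : game_ge (- G) (- H) = game_ge H G.
Proof.
have comm A B : left_wins false (A + B)%game = left_wins false (B + A)%game.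
  rewrite -!/(game_ge0 _) -!le_game0; apply/idP/idP => /le_game_trans; apply;
    exact: le_game_addC.
by rewrite /game_ge /game_ge0 game_oppK comm.
Qed.

Lemma value_oppE G : value_opp (val_of G) = val_of (- G).
Proof.
apply/val_ofP; have /andP[le1 le2] := repr_val_of G.
by rewrite /game_eqv !game_ge_opp le1 le2.
Qed.

Lemma value_ind (P : game_value -> Prop) :
  (forall G, P (val_of G)) -> forall x, P x.
Proof. by move=> PG x; rewrite -[x]reprK; exact: PG. Qed.

Lemma value_addA : associative value_add.
Proof.
elim/value_ind => G; elim/value_ind => H; elim/value_ind => K.
rewrite !value_addE; apply/val_ofP/andP.
by have [? ?] := le_game_addA G H K.
Qed.

Lemma value_addC : commutative value_add.
Proof.
elim/value_ind => G; elim/value_ind => H; rewrite !value_addE.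
by apply/val_ofP/andP; split; exact: le_game_addC.
Qed.

Definition value_zero := val_of zero_game.

Lemma value_add0 : left_id value_zero value_add.
Proof. by elim/value_ind => G; rewrite value_addC value_addE game_add0. Qed.

Lemma value_addN : left_inverse value_zero value_opp value_add.
Proof.
elim/value_ind => G; rewrite value_addC value_oppE value_addE.
apply/val_ofP; rewrite /game_eqv -[game_ge zero_game _]game_ge_opp /=.
rewrite game_oppD game_oppK !le_game0 -/(game_ge G G) le_game_refl /=.
have: game_ge (- G) (- G) by exact: le_game_refl.
by rewrite /game_ge game_oppK.
Qed.

HB.instance Definition _ := GRing.isZmodule.Build game_value
  value_addA value_addC value_add0 value_addN.

Lemma value_le_refl : reflexive value_le.
Proof. by elim/value_ind => G; rewrite value_leE le_game_refl. Qed.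

Lemma value_le_anti : antisymmetric value_le.
Proof.
elim/value_ind => G; elim/value_ind => H; rewrite !value_leE => leGH.
by apply/val_ofP; rewrite /game_eqv andbC.
Qed.

Lemma value_le_trans : transitive value_le.
Proof.
elim/value_ind => G; elim/value_ind => H; elim/value_ind => K.
by rewrite !value_leE => leHG /(le_game_trans leHG).
Qed.

HB.instance Definition _ := Order.Le_isPOrder.Build ring_display game_value
  value_le_refl value_le_anti value_le_trans.

Lemma val_of_le G H : (val_of G <= val_of H) = game_ge H G.
Proof. exact: value_leE. Qed.

Lemma val_ofD G H : val_of (G + H) = val_of G + val_of H.
Proof. by rewrite -value_addE. Qed.

Lemma val_ofN G : val_of (- G) = - val_of G.
Proof. by rewrite -value_oppE. Qed.

Lemma val_of0 : val_of zero_game = 0.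
Proof. by []. Qed.

Lemma value_leD2r (z x y : game_value) : (x + z <= y + z) = (x <= y).
Proof.
elim/value_ind: x => G; elim/value_ind: y => H; elim/value_ind: z => K.
by rewrite -!val_ofD !val_of_le le_game_add2r.
Qed.

Lemma value_leD2l (z x y : game_value) : (z + x <= z + y) = (x <= y).
Proof. by rewrite ![z + _]addrC value_leD2r. Qed.

Lemma value_leD (x y z t : game_value) : x <= y -> z <= t -> x + z <= y + t.
Proof.
by move=> lexy lezt; apply: (@le_trans _ _ (y + z));
  rewrite (value_leD2r, value_leD2l).
Qed.

Lemma value_leBlDr (x y z : game_value) : (x - y <= z) = (x <= z + y).
Proof. by rewrite -[LHS](value_leD2r y) subrK. Qed.

Lemma value_leBrDr (x y z : game_value) : (x <= y - z) = (x + z <= y).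
Proof. by rewrite -[LHS](value_leD2r z) subrK. Qed.

Lemma value_leN2 (x y : game_value) : (- x <= - y) = (y <= x).
Proof. by rewrite -[LHS](value_leD2r (x + y)) addKr addrCA addNr addr0. Qed.

Lemma val_leP G H :
  reflect ((forall l, l \in left_options G -> ~~ (val_of H <= val_of l)) /\
           (forall r, r \in right_options H -> ~~ (val_of r <= val_of G)))
          (val_of G <= val_of H).
Proof.
rewrite val_of_le; apply: (iffP (le_gameP G H)) => -[leL leR];
  by split=> x xG; rewrite (val_of_le, =^~ val_of_le); auto.
Qed.

Lemma val_left_option G l : l \in left_options G -> ~~ (val_of G <= val_of l).
Proof. by move=> lG; rewrite val_of_le left_option_nge. Qed.

Lemma val_right_option G r : r \in right_options G -> ~~ (val_of r <= val_of G).
Proof. by move=> rG; rewrite val_of_le right_option_nle. Qed.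

(** * Numbers *)

Lemma int_gameN n : int_game (- n) = (- int_game n)%game.
Proof. by case: n => [[|n]|n] //=; rewrite game_oppK. Qed.

Lemma dyadic_game_even k q : dyadic_game k.+1 (2 * q) = dyadic_game k q.
Proof. by rewrite /= dvdz_mulr // mulKz. Qed.

Lemma dyadic_game_odd k q :
  dyadic_game k.+1 (2 * q + 1) =
  Game [:: dyadic_game k q] [:: dyadic_game k (q + 1)].
Proof.
have -> : dyadic_game k.+1 (2 * q + 1) = let q' := ((2 * q + 1) %/ 2)%Z in
    if (2 %| (2 * q + 1))%Z then dyadic_game k q'
    else Game [:: dyadic_game k q'] [:: dyadic_game k (q' + 1)] by [].
have -> : (2 %| 2 * q + 1)%Z = false by apply/negP; lia.
by have -> : ((2 * q + 1) %/ 2)%Z = q by lia.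
Qed.

Variant parity_spec (m : int) : Prop :=
  | ParityEven q of m = 2 * q
  | ParityOdd q of m = 2 * q + 1.

Lemma parityP m : parity_spec m.
Proof.
have [d|d] := boolP (2 %| m)%Z.
  by apply: (@ParityEven _ (m %/ 2)%Z); lia.
by apply: (@ParityOdd _ (m %/ 2)%Z); lia.
Qed.

Lemma dyadic_gameN k m : dyadic_game k (- m) = (- dyadic_game k m)%game.
Proof.
elim: k m => [|k IH] m; first exact: int_gameN.
case: (parityP m) => q ->; first by rewrite -mulrN !dyadic_game_even.
have -> : - (2 * q + 1) = 2 * (- (q + 1)) + 1 by lia.
rewrite !dyadic_game_odd /= -!IH; congr (Game [:: _] [:: dyadic_game k _]); lia.
Qed.

(** Options are described at the same level [k], so that at a fixed level dyadic games can be
    handled through their integer numerators alone. *)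
Lemma dyadic_game_left k m l : l \in left_options (dyadic_game k m) ->
  exists2 e : int, 0 < e & l = dyadic_game k (m - e).
Proof.
elim: k m => [|k IH] m.
  case: m => [[|n]|[|n]] //=; rewrite inE => /eqP ->; exists 1 => //.
  by rewrite (_ : n.+1%:Z - 1 = n) //; lia.
case: (parityP m) => q ->.
  rewrite dyadic_game_even => /IH[e e0 ->]; exists (2 * e); first lia.
  by rewrite -mulrBr dyadic_game_even.
rewrite dyadic_game_odd inE => /eqP ->; exists 1 => //.
by rewrite addrK dyadic_game_even.
Qed.

Lemma dyadic_game_right k m r : r \in right_options (dyadic_game k m) ->
  exists2 e : int, 0 < e & r = dyadic_game k (m + e).
Proof.
rewrite -[m]opprK dyadic_gameN right_options_opp => /mapP[l /dyadic_game_left].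
case=> e e0 -> ->; exists e => //; rewrite -dyadic_gameN; congr dyadic_game; lia.
Qed.

Lemma val_nat_gameS n :
  val_of (nat_game n.+1) = val_of (nat_game n) + val_of (nat_game 1).
Proof.
rewrite -val_ofD; elim: n => [|n IH]; apply/eqP; rewrite eq_le; apply/andP;
  split; apply/val_leP; split=> // x.
- by rewrite inE => /eqP ->; apply: val_left_option; rewrite /= inE.
- by rewrite inE => /eqP ->; apply: val_left_option; rewrite /= inE.
- rewrite inE => /eqP ->.
  have := mem_left_addr (nat_game n.+1) (mem_head zero_game [::]
    : _ \in left_options (nat_game 1)).
  by rewrite game_add0; exact: val_left_option.
- case/mem_left_add=> [[y]|[y]]; rewrite inE => /eqP -> ->.
    by rewrite -[in X in _ <= X]IH; apply: val_left_option; rewrite inE.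
  by rewrite game_add0; apply: val_left_option; rewrite inE.
Qed.

Lemma val_nat_game1_gt0 : 0 < val_of (nat_game 1).
Proof.
rewrite lt_leAnge -val_of0; apply/andP; split; last first.
  by apply: val_left_option; rewrite inE.
by apply/val_leP.
Qed.

Lemma val_int_game n : val_of (int_game n) = val_of (nat_game 1) *~ n.
Proof.
have natE m : val_of (nat_game m) = val_of (nat_game 1) *~ m.
  elim: m => [|m IH]; first by rewrite mulr0z.
  by rewrite val_nat_gameS IH intS addrC mulrzDr mulr1z.
by case: n => m; rewrite /int_game ?NegzE ?mulrNz ?val_ofN natE.
Qed.

Lemma value_ltD2l (z x y : game_value) : (z + x < z + y) = (x < y).
Proof. by rewrite !lt_leAnge !value_leD2l. Qed.

Lemma int_homo_lt (f : int -> game_value) :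
  (forall m, f m < f (m + 1)) -> {mono f : m n / m <= n >-> m <= n}.
Proof.
move=> f_step; have f_lt (m n : int) : m < n -> f m < f n.
  move=> ltmn; have -> : n = m + 1 + (absz (n - m - 1)%R)%:Z by lia.
  elim: (absz _) => [|j IH]; first by rewrite addr0.
  by apply: lt_trans IH _; rewrite intS [1 + _]addrC addrA.
move=> m n; case: (leP m n) => [|/f_lt]; last first.
  by rewrite lt_leAnge => /andP[_ /negbTE].
by rewrite le_eqVlt => /predU1P[->|/f_lt /ltW]//; rewrite lexx.
Qed.

Lemma dyadic_game_le k : {mono (fun m => val_of (dyadic_game k m)) :
  m n / m <= n >-> m <= n}.
Proof.
elim: k => [|k IH]; apply: int_homo_lt => m.
  rewrite !val_int_game mulrzDr mulr1z -[X in X < _]addr0 value_ltD2l.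
  exact: val_nat_game1_gt0.
have step q : val_of (dyadic_game k.+1 (2 * q)) <
              val_of (dyadic_game k.+1 (2 * q + 1)).
  rewrite dyadic_game_even dyadic_game_odd lt_leAnge; apply/andP; split; last first.
    by apply: val_left_option; rewrite inE.
  apply/val_leP; split=> x.
    move=> /[dup] xq /dyadic_game_left[e e0 xE]; apply/negP => lex.
    have := val_left_option (mem_head (dyadic_game k q) [::] : _ \in
      left_options (Game [:: dyadic_game k q] [:: dyadic_game k (q + 1)])).
    by move=> /negP[]; apply: le_trans lex _; rewrite xE IH; lia.
  by rewrite inE => /eqP ->; rewrite IH; lia.
case: (parityP m) => q ->; first exact: step.
(* From an odd to an even numerator: the negative of a step from even to odd. *)
have -> : 2 * q + 1 + 1 = - (2 * (- (q + 1))) by lia.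
have -> : 2 * q + 1 = - (2 * (- (q + 1)) + 1) by lia.
rewrite !dyadic_gameN !val_ofN.
by have := step (- (q + 1)); rewrite !lt_leAnge !value_leN2.
Qed.

Lemma dyadic_gameD k m n :
  val_of (dyadic_game k m) + val_of (dyadic_game k n) =
  val_of (dyadic_game k (m + n)).
Proof.
elim: k m n => [|k IH] m n; first by rewrite !val_int_game mulrzDr.
(* Odd plus even is odd, so the sum has two explicit options at level [k]. Moves in the odd summand
   use [IH]; moves in the even one use an inner induction on its size. *)
have odd_even p q : val_of (dyadic_game k.+1 (2 * p + 1)) +
    val_of (dyadic_game k q) = val_of (dyadic_game k.+1 (2 * p + 1 + 2 * q)).
  have -> : 2 * p + 1 + 2 * q = 2 * (p + q) + 1 by lia.
  have [d] := ubnP (game_size (dyadic_game k q)).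
  elim: d q => // d IHd q; rewrite ltnS => sz.
  rewrite -val_ofD; apply/eqP; rewrite eq_le; apply/andP.
  rewrite dyadic_game_odd; split; apply/val_leP; split => x.
  - case/mem_left_add=> [[y]|[y]].
      rewrite inE => /eqP -> ->; rewrite val_ofD IH dyadic_game_odd.
      by apply: val_left_option; rewrite inE.
    move=> yq ->; have := left_option_size yq.
    have [e e0 yE] := dyadic_game_left yq; rewrite yE -dyadic_game_odd => lte.
    by rewrite val_ofD IHd ?dyadic_game_le; lia.
  - rewrite dyadic_game_odd inE => /eqP ->.
    have -> : p + q + 1 = p + 1 + q by lia.
    rewrite -IH -[_ + val_of (dyadic_game k q)]val_ofD.
    by apply/val_right_option/mem_right_addl; rewrite inE.
  - rewrite dyadic_game_odd inE => /eqP ->.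
    rewrite -IH -[_ + val_of (dyadic_game k q)]val_ofD.
    by apply/val_left_option/mem_left_addl; rewrite inE.
  - case/mem_right_add=> [[y]|[y]].
      rewrite inE => /eqP -> ->; rewrite val_ofD IH dyadic_game_odd.
      have -> : p + 1 + q = p + q + 1 by lia.
      by apply: val_right_option; rewrite inE.
    move=> yq ->; have := right_option_size yq.
    have [e e0 yE] := dyadic_game_right yq; rewrite yE -dyadic_game_odd => lte.
    by rewrite val_ofD IHd ?dyadic_game_le; lia.
(* A move in an odd summand makes it even, which brings back [odd_even]. One inequality suffices,
   because negation preserves oddness and yields the other. *)
have odd_odd_le p q : val_of (dyadic_game k.+1 (2 * p + 1)) +
    val_of (dyadic_game k.+1 (2 * q + 1)) <=
    val_of (dyadic_game k.+1 (2 * p + 1 + (2 * q + 1))).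
  rewrite -val_ofD; have sE : 2 * p + 1 + (2 * q + 1) = 2 * (p + q + 1) by lia.
  apply/val_leP; split => x.
    case/mem_left_add=> [[y]|[y]]; rewrite dyadic_game_odd inE => /eqP -> ->.
      rewrite val_ofD [val_of _ + _]addrC odd_even dyadic_game_le; lia.
    rewrite val_ofD odd_even dyadic_game_le; lia.
  rewrite sE dyadic_game_even => /dyadic_game_right[e e0 ->]; apply/negP => lex.
  have : (dyadic_game k (p + 1) + dyadic_game k.+1 (2 * q + 1))%game \in
      right_options (dyadic_game k.+1 (2 * p + 1) + dyadic_game k.+1 (2 * q + 1)).
    by apply: mem_right_addl; rewrite dyadic_game_odd inE.
  move=> /val_right_option/negP[]; apply: le_trans lex.
  rewrite val_ofD [val_of _ + _]addrC odd_even -[dyadic_game k (_ + _)]dyadic_game_even.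
  rewrite dyadic_game_le; lia.
case: (parityP m) => p ->; case: (parityP n) => q ->.
- by rewrite !dyadic_game_even IH -mulrDr dyadic_game_even.
- by rewrite dyadic_game_even [val_of _ + _]addrC odd_even addrC.
- by rewrite dyadic_game_even odd_even.
apply/eqP; rewrite eq_le odd_odd_le andTb.
rewrite -value_leN2 opprD -!val_ofN -!dyadic_gameN.
have := odd_odd_le (- (p + 1)) (- (q + 1)).
have oddN (i : int) : 2 * - (i + 1) + 1 = - (2 * i + 1) by lia.
by rewrite !oddN -opprD.
Qed.

Lemma pow2_gt0 k : 0 < 2%:R ^+ k :> rat.
Proof. exact: exprn_gt0. Qed.

Lemma num_dyadic_game k (m : int) : num_game (m%:~R / 2%:R ^+ k) = dyadic_game k m.
Proof.
elim: k m => [|k IH] m.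
  by rewrite expr0 divr1 /num_game numq_int denq_int logn1.
case: (parityP m) => q ->.
  rewrite dyadic_game_even -IH; congr num_game; rewrite intrM exprS.
  by rewrite -mulf_div divff ?mul1r.
have cop : coprime `|(2 * q + 1)%R| `|(2%:R ^+ k.+1)%R : int|.
  rewrite abszX coprimeXr //= coprimen2; lia.
have -> : (2 * q + 1)%:~R / 2%:R ^+ k.+1 =
  (2 * q + 1)%:~R / (2%:R ^+ k.+1 : int)%:~R :> rat.
  by congr (_ / _); rewrite rmorphXn.
rewrite /num_game coprimeq_num // coprimeq_den //.
have -> : (2%:R ^+ k.+1 == 0 :> int) = false by apply/negbTE/expf_neq0.
have -> : Num.sg (2%:R ^+ k.+1 : int) = 1 by rewrite gtr0_sg // exprn_gt0.
by rewrite mul1r absz_id abszX pfactorK.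
Qed.

Definition num_value (x : rat) : game_value := val_of (num_game x).

Lemma dyadic_common x y : is_dyadic x -> is_dyadic y ->
  exists k (m n : int), x = m%:~R / 2%:R ^+ k /\ y = n%:~R / 2%:R ^+ k.
Proof.
move=> [m [i ->]] [n [j ->]]; exists (i + j)%N, (m * 2 ^+ j), (n * 2 ^+ i).
have := pow2_gt0 i; have := pow2_gt0 j; rewrite !intrM !rmorphXn exprD /=.
by move=> ? ?; split; field; rewrite ?expf_neq0.
Qed.

Lemma dyadic_int n : is_dyadic n%:~R.
Proof. by exists n, 0%N; rewrite expr0 divr1. Qed.

Lemma dyadicD x y : is_dyadic x -> is_dyadic y -> is_dyadic (x + y).
Proof.
move=> dx dy; have [k [m [n [-> ->]]]] := dyadic_common dx dy.
by exists (m + n), k; rewrite intrD mulrDl.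
Qed.

Lemma dyadicN x : is_dyadic x -> is_dyadic (- x).
Proof. by move=> [m [k ->]]; exists (- m), k; rewrite intrN mulNr. Qed.

Lemma dyadicB x y : is_dyadic x -> is_dyadic y -> is_dyadic (x - y).
Proof. by move=> dx /dyadicN; exact: dyadicD. Qed.

Lemma dyadicM_int x (n : int) : is_dyadic x -> is_dyadic (n%:~R * x).
Proof. by move=> [m [k ->]]; exists (n * m), k; rewrite intrM mulrA. Qed.

Lemma dyadic_div x k : is_dyadic x -> is_dyadic (x / 2%:R ^+ k).
Proof. by move=> [m [j ->]]; exists m, (j + k)%N; rewrite exprD invfM mulrA. Qed.

Lemma num_valueD x y : is_dyadic x -> is_dyadic y ->
  num_value (x + y) = num_value x + num_value y.
Proof.
move=> dx dy; have [k [m [n [-> ->]]]] := dyadic_common dx dy.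
by rewrite -mulrDl -intrD /num_value !num_dyadic_game dyadic_gameD.
Qed.

Lemma num_value_le x y : is_dyadic x -> is_dyadic y ->
  (num_value x <= num_value y) = (x <= y).
Proof.
move=> dx dy; have [k [m [n [-> ->]]]] := dyadic_common dx dy.
rewrite /num_value !num_dyadic_game dyadic_game_le.
by rewrite ler_pM2r ?invr_gt0 ?pow2_gt0 // ler_int.
Qed.

Lemma num_int_game n : num_game n%:~R = int_game n.
Proof. by rewrite -[n%:~R]divr1 -(expr0 2%:R) num_dyadic_game. Qed.

Lemma num_value_int n : num_value n%:~R = val_of (int_game n).
Proof. by rewrite /num_value num_int_game. Qed.

Lemma num_value0 : num_value 0 = 0.
Proof. exact: (num_value_int 0). Qed.

Lemma num_gameN x : is_dyadic x -> num_game (- x) = (- num_game x)%game.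
Proof.
by move=> [m [k ->]]; rewrite -mulNr -intrN !num_dyadic_game dyadic_gameN.
Qed.

Lemma num_valueN x : is_dyadic x -> num_value (- x) = - num_value x.
Proof. by move=> dx; rewrite /num_value num_gameN // val_ofN. Qed.

Lemma num_valueB x y : is_dyadic x -> is_dyadic y ->
  num_value (x - y) = num_value x - num_value y.
Proof. by move=> dx dy; rewrite num_valueD ?num_valueN //; exact: dyadicN. Qed.

Lemma num_game_right x r : is_dyadic x -> r \in right_options (num_game x) ->
  exists2 y, is_dyadic y /\ x < y & r = num_game y.
Proof.
move=> [m [k ->]]; rewrite num_dyadic_game => /dyadic_game_right[e e0 ->].
exists ((m + e)%:~R / 2%:R ^+ k); last by rewrite num_dyadic_game.
split; first by exists (m + e), k.
by rewrite ltr_pM2r ?invr_gt0 ?pow2_gt0 // ltr_int ltrDl.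
Qed.

Lemma num_game_left x l : is_dyadic x -> l \in left_options (num_game x) ->
  exists2 y, is_dyadic y /\ y < x & l = num_game y.
Proof.
move=> [m [k ->]]; rewrite num_dyadic_game => /dyadic_game_left[e e0 ->].
exists ((m - e)%:~R / 2%:R ^+ k); last by rewrite num_dyadic_game.
split; first by exists (m - e), k.
by rewrite ltr_pM2r ?invr_gt0 ?pow2_gt0 // ltr_int gtrBl.
Qed.

(** * Piecewise linear functions *)

Lemma floor_multiple (x d : rat) : 0 < d ->
  exists2 n : int, n%:~R * d <= x & x <= (n + 1)%:~R * d.
Proof.
move=> d0; exists (Num.floor (x / d)); first by rewrite -ler_pdivlMr // floor_le.
by rewrite -ler_pdivrMr // ltW // floorD1_gt.
Qed.

Definition mesh (k : nat) : rat := (2%:R ^+ k)^-1.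

Lemma mesh_gt0 k : 0 < mesh k.
Proof. by rewrite invr_gt0 pow2_gt0. Qed.

Lemma meshS k : mesh k = mesh k.+1 + mesh k.+1.
Proof. by rewrite /mesh exprS; have := pow2_gt0 k => ?; field; rewrite ?expf_neq0. Qed.

Lemma dyadic_mesh k (j : int) : is_dyadic (j%:~R * mesh k).
Proof. by exists j, k. Qed.

Lemma dyadic_on_mesh x : is_dyadic x ->
  exists i, forall k, (i <= k)%N -> exists j : int, x = j%:~R * mesh k.
Proof.
move=> [m [i ->]]; exists i => k leik; exists (m * 2 ^+ (k - i)).
rewrite /mesh intrM rmorphXn -[in 2%:R ^+ k](subnK leik) exprD /=.
by field; rewrite !expf_neq0.
Qed.

(** Left stops have [c = -1] and right stops [c = 0]. Cells are closed, so neighbouring formulas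
    agree at the common end and continuity is built in. *)
Definition piecewise k (c : int) (f : rat -> rat) := forall j : int,
  exists a b : int, [/\ b = c \/ b = c + 1 & forall t,
    j%:~R * mesh k <= t <= (j + 1)%:~R * mesh k ->
    f t = a%:~R * mesh k + b%:~R * (t - j%:~R * mesh k)].

Lemma piecewise_refine k c f : piecewise k c f -> piecewise k.+1 c f.
Proof.
move=> pf j; have := meshS k; have := mesh_gt0 k.+1 => h0 hE.
case: (parityP j) => q ->; have [a [b [bc fE]]] := pf q.
  exists (2 * a), b; split=> // t; rewrite !intrD !intrM => tb.
  rewrite fE ?hE ?intrD; first lra.
  move: tb; set x := q%:~R; set y := mesh k.+1 => tb; lra.
exists (2 * a + b), b; split=> // t; rewrite !intrD !intrM => tb.
rewrite fE ?hE ?intrD; first lra.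
move: tb; set x := q%:~R; set y := mesh k.+1 => tb; lra.
Qed.

Lemma piecewise_leq k k' c f : (k <= k')%N -> piecewise k c f -> piecewise k' c f.
Proof.
move=> lekk' pf; rewrite -(subnKC lekk').
elim: (k' - k)%N => [|d IH]; first by rewrite addn0.
by rewrite addnS; exact: piecewise_refine.
Qed.

Lemma piecewise_cst k c (n : int) : c = 0 \/ c = -1 -> piecewise k c (fun=> n%:~R).
Proof.
move=> hc j; exists (n * 2 ^+ k), 0; split; first by case: hc => ->; auto.
move=> t _; rewrite mul0r addr0 intrM rmorphXn /mesh /=.
by rewrite mulfK // expf_neq0.
Qed.

Lemma piecewiseN k c f : piecewise k c f -> piecewise k (- c - 1) (fun t => - f t).
Proof.
move=> pf j; have [a [b [bc fE]]] := pf j; exists (- a), (- b).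
split; first by case: bc => ->; [right|left]; lia.
by move=> t /fE ->; rewrite !intrN; lra.
Qed.

Lemma piecewiseD_id k c f : piecewise k c f -> piecewise k (c + 1) (fun t => f t + t).
Proof.
move=> pf j; have [a [b [bc fE]]] := pf j; exists (a + j), (b + 1).
split; first by case: bc => ->; [left|right].
by move=> t /fE ->; rewrite !intrD; lra.
Qed.

Lemma piecewiseB_id k c f : piecewise k c f -> piecewise k (c - 1) (fun t => f t - t).
Proof.
move=> pf j; have [a [b [bc fE]]] := pf j; exists (a - j), (b - 1).
split; first by case: bc => ->; [left|right]; lia.
by move=> t /fE ->; rewrite !intrB; lra.
Qed.

(** Two such lines never cross inside a cell: their heights at its left end differ by a multiple of
    the mesh and their slopes by at most 1, so closing a nonzero gap takes the whole cell. *)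
Lemma piecewise_max k c f g : piecewise k c f -> piecewise k c g ->
  piecewise k c (fun t => Num.max (f t) (g t)).
Proof.
move=> pf pg j; have [a [b [bc fE]]] := pf j; have [a' [b' [bc' gE]]] := pg j.
have [a1 [b1 [a2 [b2 [bc1 bc2 ab abE]]]]] : exists a1 b1 a2 b2 : int,
    [/\ b1 = c \/ b1 = c + 1, b2 = c \/ b2 = c + 1,
     a2 < a1 \/ (a1 = a2 /\ b2 <= b1) &
     (a1, b1, (a2, b2)) = (a, b, (a', b')) \/
     (a1, b1, (a2, b2)) = (a', b', (a, b))].
  case: (ltrgtP a' a) => [lt|lt|eq].
  - by exists a, b, a', b'; split; auto.
  - by exists a', b', a, b; split; auto.
  case: (lerP b' b) => [le|/ltW le].
    by exists a, b, a', b'; split; auto.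
  by exists a', b', a, b; split; auto.
exists a1, b1; split=> // t tb; rewrite fE // gE //.
have dom : a2%:~R * mesh k + b2%:~R * (t - j%:~R * mesh k) <=
    a1%:~R * mesh k + b1%:~R * (t - j%:~R * mesh k).
  move: tb; rewrite intrD mulrDl mul1r => /andP[t1 t2].
  set d := t - _; have d0 : 0 <= d by rewrite /d; lra.
  have dh : d <= mesh k by rewrite /d; lra.
  case: ab => [ltaa|[-> lebb]]; last first.
    by rewrite lerD2l ler_wpM2r // ler_int.
  have : (a2 + 1)%:~R * mesh k <= a1%:~R * mesh k.
    by rewrite ler_pM2r ?mesh_gt0 // ler_int; lia.
  have : b2%:~R * d <= (b1 + 1)%:~R * d.
    by rewrite ler_wpM2r // ler_int; lia.
  rewrite !intrD; lra.
by case: abE => -[e1 e2 e3 e4]; subst; [apply: max_l | apply: max_r].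
Qed.

(** The constant part has slope 0, which must be [c] or [c + 1]. *)
Lemma piecewise_freeze k c f (j0 : int) : c = 0 \/ c = -1 -> piecewise k c f ->
  piecewise k c (fun t => if t <= j0%:~R * mesh k then f t
                          else f (j0%:~R * mesh k)).
Proof.
move=> hc pf j; have h0 := mesh_gt0 k.
have [ltjj|lejj] := ltP j j0.
  have [a [b [bc fE]]] := pf j; exists a, b; split=> // t tb.
  rewrite ifT ?fE //; move/andP: tb => [_ tb]; apply: le_trans tb _.
  by rewrite ler_pM2r // ler_int; lia.
have [a [b [_ fE]]] := pf j0; exists a, 0; split; first by case: hc => ->; auto.
move=> t /andP[tj _]; rewrite mul0r addr0.
have f0 : f (j0%:~R * mesh k) = a%:~R * mesh k.
  by rewrite fE ?subrr ?mulr0 ?addr0 // lexx ler_pM2r // ler_int; lia.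
case: ifP => // tj0; suff -> : t = j0%:~R * mesh k by [].
apply/eqP; rewrite eq_le tj0; apply: le_trans tj.
by rewrite ler_pM2r // ler_int.
Qed.

Lemma piecewise_dyadic k c f t :
  piecewise k c f -> is_dyadic t -> is_dyadic (f t).
Proof.
move=> pf /dyadic_on_mesh[i on_mesh].
have [j ->] := on_mesh _ (leq_addl k i).
have [a [b [_ fE]]] := piecewise_leq (leq_addr i k) pf j.
rewrite fE ?subrr ?mulr0 ?addr0; first exact: dyadic_mesh.
by rewrite lexx ler_pM2r ?mesh_gt0 // ler_int; lia.
Qed.

Lemma int_last (P : int -> Prop) (i j : int) : i <= j -> P i -> ~ P j ->
  exists2 n, P n & ~ P (n + 1).
Proof.
move=> leij Pi; have -> : j = i + (absz (j - i)%R)%:Z by lia.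
elim: (absz _) => [|d IH]; first by rewrite addr0.
have [Pd|/IH//] := pselect (P (i + d%:Z)) => nPd.
by exists (i + d%:Z) => //; rewrite -addrA [_ + 1]addrC -intS.
Qed.

(** The difference of the two walls has slopes in [{0, -1, -2}], so its first
    zero lies on the mesh or halfway between two mesh points. *)
Lemma piecewise_meet k f g s0 s1 :
  piecewise k (-1) f -> piecewise k 0 g ->
  {homo f : x y /~ x <= y} -> {homo g : x y / x <= y} ->
  g s0 < f s0 -> f s1 < g s1 ->
  exists2 j : int, f (j%:~R * mesh k.+1) = g (j%:~R * mesh k.+1) &
    forall s, f s = g s -> j%:~R * mesh k.+1 <= s.
Proof.
move=> pf pg monof monog gt0 lt1; have h0 := mesh_gt0 k.
have before x y : x <= y -> g y < f y -> g x < f x.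
  by move=> xy /(le_lt_trans (monog _ _ xy))/lt_le_trans; apply; apply: monof.
have [i i0 _] := floor_multiple s0 h0; have [j _ j1] := floor_multiple s1 h0.
have Pi : g (i%:~R * mesh k) < f (i%:~R * mesh k) by exact: before gt0.
have Pj : ~ (g ((j + 1)%:~R * mesh k) < f ((j + 1)%:~R * mesh k)).
  by move/(before _ _ j1); rewrite ltNge ltW.
have leij : i <= j + 1.
  rewrite leNgt; apply/negP => ltji; apply: Pj; apply: before Pi.
  by rewrite ler_pM2r // ler_int ltW.
have [n Pn nPn] := int_last
  (P := fun n : int => g (n%:~R * mesh k) < f (n%:~R * mesh k)) leij Pi Pj.
have [a [b [bc fE]]] := pf n; have [a' [b' [bc' gE]]] := pg n.
have := meshS k; have h0' := mesh_gt0 k.+1 => hE.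
have cell t : n%:~R * mesh k <= t <= (n + 1)%:~R * mesh k ->
    f t - g t = (a - a')%:~R * mesh k + (b - b')%:~R * (t - n%:~R * mesh k).
  by move=> tb; rewrite fE // gE // !intrB; lra.
have succ : (n + 1)%:~R * mesh k = n%:~R * mesh k + mesh k.
  by rewrite intrD mulrDl mul1r.
have a0 : 0 < a - a'.
  have := cell (n%:~R * mesh k); rewrite succ lexx lerDl ltW // => /(_ isT).
  rewrite subrr mulr0 addr0 => dE.
  by move: Pn; rewrite -subr_gt0 dE pmulr_lgt0 // ltr0z.
have ab0 : a - a' + (b - b') <= 0.
  have := cell ((n + 1)%:~R * mesh k); rewrite succ lexx lerDl ltW // => /(_ isT).
  have -> : n%:~R * mesh k + mesh k - n%:~R * mesh k = mesh k by lra.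
  rewrite -mulrDl -intrD => dE.
  move/negP: nPn; rewrite -leNgt -subr_le0 succ dE pmulr_lle0 //.
  by rewrite -[0]/(0%:~R) ler_int.
have after s : f s = g s -> n%:~R * mesh k < s.
  by move=> fgs; rewrite ltNge; apply/negP => /before/(_ Pn); rewrite fgs ltxx.
have dn : n%:~R * mesh k = (2 * n)%:~R * mesh k.+1 by rewrite hE intrM; lra.
have D0 (x y : rat) : x - y = 0 -> x = y by move/eqP; rewrite subr_eq0 => /eqP.
(* In mesh units the gap [a - a'] is positive at the left end and not positive at the right end,
   with slope 0, -1 or -2. Only gap 1 with slope -2 closes halfway; the two other cases close at the
   right end. *)
have [[bE aE]|ab] : (b - b' = -2 /\ a - a' = 1) \/
    (b - b' = -2 /\ a - a' = 2 \/ b - b' = -1 /\ a - a' = 1) by lia.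
  exists (2 * n + 1); rewrite intrD mulrDl mul1r -dn.
    by apply: D0; rewrite cell ?aE ?bE ?succ; lra.
  move=> s fgs; rewrite leNgt; apply/negP => lts.
  have := after s fgs => ngs; have := cell s; rewrite succ fgs subrr aE bE.
  by move=> /(_ ltac:(lra)); lra.
exists (2 * n + 2); rewrite intrD mulrDl -dn.
  apply: D0; rewrite cell ?succ; last lra.
  by case: ab => -[-> ->]; lra.
move=> s fgs; rewrite leNgt; apply/negP => lts.
have := after s fgs => ngs; have := cell s; rewrite succ fgs subrr.
by move=> /(_ ltac:(lra)); case: ab => -[-> ->]; lra.
Qed.

(** * Walls and stops *)

Lemma seq_max_in s : s != [::] -> seq_max s \in s.
Proof.
case: s => // x s _; rewrite /seq_max big_cons /=.
have : \big[Num.max/x]_(y <- s) y \in x :: s.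
  elim: s => [|y s IH]; first by rewrite big_nil mem_head.
  rewrite big_cons maxEle; case: ifP => _; last by rewrite !inE eqxx orbT.
  by move: IH; rewrite !inE => /orP[->|->]; rewrite ?orbT.
by rewrite maxEle; case: ifP => // _ _; rewrite mem_head.
Qed.

Lemma seq_max_ge s x : x \in s -> x <= seq_max s.
Proof.
rewrite /seq_max; move: (head 0 s) => y.
elim: s => // z s IH; rewrite inE big_cons le_max => /predU1P[->|/IH ->].
  by rewrite lexx.
by rewrite orbT.
Qed.

Lemma seq_minN s : seq_min s = - seq_max [seq - x | x <- s].
Proof.
case: s => [|y s]; first by rewrite /seq_min /seq_max !big_nil oppr0.
rewrite /seq_min /seq_max big_map /=; elim: (y :: s) => [|x r IH].
  by rewrite !big_nil opprK.
by rewrite !big_cons oppr_max IH opprK.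
Qed.

Lemma seq_min_in s : s != [::] -> seq_min s \in s.
Proof.
move=> s0; rewrite seq_minN.
have : seq_max [seq - x | x <- s] \in [seq - x | x <- s].
  by apply: seq_max_in; case: s s0.
by case/mapP => x xs ->; rewrite opprK.
Qed.

Lemma seq_min_le s x : x \in s -> seq_min s <= x.
Proof. by move=> xs; rewrite seq_minN lerNl seq_max_ge // map_f. Qed.

Lemma int_value_some G n : int_value G = Some n -> val_of G = num_value n%:~R.
Proof.
rewrite /int_value; case: pselect => // ex [<-].
by rewrite num_value_int; apply/val_ofP; exact: xchooseP ex.
Qed.

Lemma int_value_none G :
  int_value G = None -> forall n, val_of G <> num_value n%:~R.
Proof.
rewrite /int_value; case: pselect => // nex _ n.
by rewrite num_value_int => /val_ofP Gn; apply: nex; exists n.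
Qed.

(** These are the quantities of the recursion before truncation at the temperature. *)
Definition left_wall t G := seq_max [seq stop_right t l - t | l <- left_options G].
Definition right_wall t G := seq_min [seq stop_left t r + t | r <- right_options G].
Definition freezing_temp G :=
  set_min [set t | is_dyadic t /\ left_wall t G = right_wall t G]%classic.
Definition raw_cool t G :=
  Game [seq (cool t l - num_game t)%game | l <- left_options G]
       [seq (cool t r + num_game t)%game | r <- right_options G].

Lemma stop_left_int t G n : int_value G = Some n -> stop_left t G = n%:~R.
Proof. by case: G => GL GR; rewrite /stop_left /= => ->. Qed.

Lemma stop_right_int t G n : int_value G = Some n -> stop_right t G = n%:~R.
Proof. by case: G => GL GR; rewrite /stop_right /= => ->. Qed.

Lemma cool_int t G n : int_value G = Some n -> cool t G = int_game n.
Proof. by case: G => GL GR; rewrite /cool /= => ->. Qed.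

Lemma stop_leftE t G : int_value G = None -> stop_left t G =
  if t <= freezing_temp G then left_wall t G else left_wall (freezing_temp G) G.
Proof. by case: G => GL GR; rewrite {1}/stop_left /= => ->. Qed.

Lemma stop_rightE t G : int_value G = None -> stop_right t G =
  if t <= freezing_temp G then right_wall t G else left_wall (freezing_temp G) G.
Proof. by case: G => GL GR; rewrite {1}/stop_right /= => ->. Qed.

Lemma coolE t G : int_value G = None -> cool t G =
  if t <= freezing_temp G then raw_cool t G
  else num_game (left_wall (freezing_temp G) G).
Proof. by case: G => GL GR; rewrite {1}/cool /= => ->. Qed.

Lemma left_wall_ge t G l :
  l \in left_options G -> stop_right t l - t <= left_wall t G.
Proof. by move=> lG; apply: seq_max_ge; apply/mapP; exists l. Qed.

Lemma right_wall_le t G r :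
  r \in right_options G -> right_wall t G <= stop_left t r + t.
Proof. by move=> rG; apply: seq_min_le; apply/mapP; exists r. Qed.

Lemma left_wall_ex t G : left_options G != [::] ->
  exists2 l, l \in left_options G & left_wall t G = stop_right t l - t.
Proof.
move=> G0; have: left_wall t G \in [seq stop_right t l - t | l <- left_options G].
  by apply: seq_max_in; case: (left_options G) G0.
by case/mapP => l; exists l.
Qed.

Lemma right_wall_ex t G : right_options G != [::] ->
  exists2 r, r \in right_options G & right_wall t G = stop_left t r + t.
Proof.
move=> G0; have: right_wall t G \in [seq stop_left t r + t | r <- right_options G].
  by apply: seq_min_in; case: (right_options G) G0.
by case/mapP => r; exists r.
Qed.

(** Simplicity, by walking towards 0: if [n] fits between the options and [G] is not [n], then the
    neighbour of [n] nearer to 0 fits as well. *)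
Lemma simplest_int G n :
  (forall l, l \in left_options G -> ~~ (num_value n%:~R <= val_of l)) ->
  (forall r, r \in right_options G -> ~~ (val_of r <= num_value n%:~R)) ->
  exists n, val_of G = num_value n%:~R.
Proof.
have [d] := ubnP (absz n); elim: d n => // d IH n; rewrite ltnS => lenD hL hR.
have lt_int (i j : int) : i < j -> num_value i%:~R <= num_value j%:~R.
  by move=> ltij; rewrite num_value_le ?ler_int ?ltW //; exact: dyadic_int.
case: n lenD hL hR => [[|j]|j] lenD hL hR.
- exists 0; rewrite num_value_int /= in hL hR *; apply/eqP; rewrite eq_le.
  by apply/andP; split; apply/val_leP; split.
- have [lej|nlej] := boolP (val_of G <= num_value j%:~R).
    apply: (IH j) => //.
    + move=> l lG; apply/negP => ltj; move/negP: (val_left_option lG); apply.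
      exact: le_trans lej ltj.
    + move=> r rG; apply: contra (hR r rG) => /le_trans; apply.
      by apply: lt_int; rewrite ltz_nat.
  exists j.+1; rewrite num_value_int /= in hL hR nlej *.
  apply/eqP; rewrite eq_le; apply/andP; split; apply/val_leP; split => // x.
  by rewrite inE => /eqP ->; rewrite num_value_int in nlej.
- have [lej|nlej] := boolP (num_value (- j%:Z)%:~R <= val_of G).
    apply: (IH (- j%:Z)); first by rewrite abszN.
    + move=> l lG; apply: contra (hL l lG); apply: le_trans.
      by apply: lt_int; lia.
    + move=> r rG; apply/negP => ltj; move/negP: (val_right_option rG); apply.
      exact: le_trans ltj lej.
  exists (Negz j); rewrite !num_value_int /= in hL hR nlej *.
  apply/eqP; rewrite eq_le; apply/andP; split; apply/val_leP; split => // x.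
  by rewrite inE => /eqP ->; rewrite int_gameN in nlej.
Qed.

(** * Shape of the thermograph and its base at temperature -1 *)

Definition stops_monotone G := forall s t, s <= t ->
  [/\ stop_left t G <= stop_left s G, stop_left s G <= stop_left t G + (t - s),
      stop_right s G <= stop_right t G &
      stop_right t G <= stop_right s G + (t - s)].

Definition stops_piecewise G := exists k,
  piecewise k (-1) (stop_left ^~ G) /\ piecewise k 0 (stop_right ^~ G).

Definition stops_base G := exists l r : int,
  [/\ stop_left (-1) G = l%:~R, stop_right (-1) G = r%:~R,
      num_value r%:~R <= val_of G <= num_value l%:~R,
      ~~ (num_value (r + 1)%:~R <= val_of G) &
      ~~ (val_of G <= num_value (l - 1)%:~R)].

Definition stops_spec G := [/\ stops_monotone G, stops_piecewise G,
  stops_base G & forall t, stop_right t G <= stop_left t G].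

Definition freezing_spec G := [/\ is_dyadic (freezing_temp G),
  left_wall (freezing_temp G) G = right_wall (freezing_temp G) G,
  -1 < freezing_temp G, left_options G != [::] & right_options G != [::]].

Lemma seq_piecewise (s : seq game) (f : rat -> game -> rat) (c : int) :
  (forall g, g \in s -> exists k, piecewise k c (f ^~ g)) ->
  exists k, forall g, g \in s -> piecewise k c (f ^~ g).
Proof.
elim: s => [|g s IH] h; first by exists 0%N.
have [|k1 h1] := IH; first by move=> x xs; apply: h; rewrite inE xs orbT.
have [k2 h2] := h g (mem_head _ _); exists (maxn k1 k2) => x.
rewrite inE => /predU1P[->|/h1]; first exact: piecewise_leq (leq_maxr _ _) h2.
exact: piecewise_leq (leq_maxl _ _).
Qed.

Lemma piecewise_seq_max (s : seq game) (f : rat -> game -> rat) k (c : int) :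
  s != [::] -> (forall g, g \in s -> piecewise k c (f ^~ g)) ->
  piecewise k c (fun t => seq_max [seq f t g | g <- s]).
Proof.
case: s => // g0 s _ h.
have h0 : piecewise k c (f ^~ g0) by apply: h; rewrite mem_head.
suff gen r : (forall g, g \in r -> piecewise k c (f ^~ g)) ->
    piecewise k c (fun t => \big[Num.max/f t g0]_(x <- [seq f t g | g <- r]) x).
  exact: gen h.
elim: r => [|g r IH] hr; first by under eq_fun do rewrite /= big_nil.
under eq_fun do rewrite /= big_cons; apply: piecewise_max.
  by apply: hr; rewrite mem_head.
by apply: IH => x xr; apply: hr; rewrite inE xr orbT.
Qed.

Lemma piecewise_seq_min (s : seq game) (f : rat -> game -> rat) k (c : int) :
  s != [::] -> (forall g, g \in s -> piecewise k c (f ^~ g)) ->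
  piecewise k c (fun t => seq_min [seq f t g | g <- s]).
Proof.
move=> s0 h; have -> : c = - (- c - 1) - 1 by lia.
under eq_fun do rewrite seq_minN -map_comp; apply: piecewiseN.
apply: (@piecewise_seq_max s (fun t g => - f t g)) => // g gs.
by apply: piecewiseN; exact: h.
Qed.

Lemma num_value_ler_int (i j : int) :
  (num_value i%:~R <= num_value j%:~R) = (i <= j).
Proof. by rewrite num_value_le ?ler_int //; exact: dyadic_int. Qed.

Lemma left_wall_base G : (forall l, l \in left_options G -> stops_base l) ->
  exists n : int, left_wall (-1) G = n%:~R.
Proof.
move=> hL; have [G0|/(left_wall_ex (-1))[l lG ->]] := eqVneq (left_options G) [::].
  by exists 0; rewrite /left_wall G0 /seq_max big_nil.
have [_ [n [_ -> _ _ _]]] := hL l lG; exists (n + 1).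
by rewrite opprK intrD.
Qed.

Lemma right_wall_base G : (forall r, r \in right_options G -> stops_base r) ->
  exists n : int, right_wall (-1) G = n%:~R.
Proof.
move=> hR; have [G0|/(right_wall_ex (-1))[r rG ->]] := eqVneq (right_options G) [::].
  by exists 0; rewrite /right_wall G0 /seq_min big_nil.
have [n [_ [-> _ _ _ _]]] := hR r rG; exists (n - 1).
by rewrite intrB.
Qed.

(** At -1 the tax turns the floor [r] of a Left option into [r + 1], the first integer which that
    option does not reach. *)
Lemma left_wall_base_ub G (n : int) :
  (forall l, l \in left_options G -> stops_base l) ->
  left_wall (-1) G <= n%:~R ->
  forall l, l \in left_options G -> ~~ (num_value n%:~R <= val_of l).
Proof.
move=> hL leln l lG; have := le_trans (left_wall_ge (-1) lG) leln.
have [_ [r [_ -> _ nr _]]] := hL l lG.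
rewrite opprK -[1]/(1%:~R) -intrD ler_int => lern.
by apply: contra nr => /(le_trans _); apply; rewrite num_value_ler_int.
Qed.

Lemma right_wall_base_lb G (n : int) :
  (forall r, r \in right_options G -> stops_base r) ->
  n%:~R <= right_wall (-1) G ->
  forall r, r \in right_options G -> ~~ (val_of r <= num_value n%:~R).
Proof.
move=> hR lenr r rG; have := le_trans lenr (right_wall_le (-1) rG).
have [l [_ [-> _ _ _ nl]]] := hR r rG.
rewrite -[-1]/((-1)%:~R) -intrD ler_int => lern.
by apply: contra nl => /le_trans; apply; rewrite num_value_ler_int.
Qed.

(** If the walls were not crossed at -1, or if one side had no options, some integer would fit
    between the Left and Right options, and [simplest_int] would make [G] an integer. *)
Lemma walls_base G : (forall l, l \in left_options G -> stops_base l) ->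
  (forall r, r \in right_options G -> stops_base r) ->
  (forall n, val_of G <> num_value n%:~R) ->
  [/\ left_options G != [::], right_options G != [::] &
      right_wall (-1) G < left_wall (-1) G].
Proof.
move=> hL hR nint; have [a aE] := left_wall_base hL.
have [b bE] := right_wall_base hR.
have nofit (n : int) :
    (forall l, l \in left_options G -> ~~ (num_value n%:~R <= val_of l)) ->
    (forall r, r \in right_options G -> ~~ (val_of r <= num_value n%:~R)) -> False.
  by move=> fl fr; have [m /nint] := simplest_int fl fr.
have fitb := right_wall_base_lb (n := b) hR; rewrite bE lexx in fitb.
have fita := left_wall_base_ub (n := a) hL; rewrite aE lexx in fita.
have L0 : left_options G != [::].
  apply/eqP => L0; apply: (nofit b) (fitb isT) => l; by rewrite L0.
have R0 : right_options G != [::].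
  apply/eqP => R0; apply: (nofit a) (fita isT) _ => r; by rewrite R0.
split=> //; rewrite ltNge; apply/negP => leab; apply: (nofit a (fita isT)).
by apply: right_wall_base_lb; rewrite // -aE.
Qed.

(** Right stops of options rise at a rate between 0 and 1; subtracting [t] turns this into a fall at
    such a rate. *)
Lemma left_wall_lip G : left_options G != [::] ->
  (forall l, l \in left_options G -> stops_monotone l) ->
  forall s t, s <= t -> left_wall t G <= left_wall s G <= left_wall t G + (t - s).
Proof.
move=> L0 hL s t st; apply/andP; split.
  have [l lG ->] := left_wall_ex t L0; have [_ _ _ h] := hL l lG s t st.
  by have := left_wall_ge s lG; lra.
have [l lG ->] := left_wall_ex s L0; have [_ _ h _] := hL l lG s t st.
by have := left_wall_ge t lG; lra.
Qed.

Lemma right_wall_lip G : right_options G != [::] ->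
  (forall r, r \in right_options G -> stops_monotone r) ->
  forall s t, s <= t ->
    right_wall s G <= right_wall t G <= right_wall s G + (t - s).
Proof.
move=> R0 hR s t st; apply/andP; split.
  have [r rG ->] := right_wall_ex t R0; have [_ h _ _] := hR r rG s t st.
  by have := right_wall_le s rG; lra.
have [r rG ->] := right_wall_ex s R0; have [h _ _ _] := hR r rG s t st.
by have := right_wall_le t rG; lra.
Qed.

Lemma left_wall_piecewise G : left_options G != [::] ->
  (forall l, l \in left_options G -> stops_piecewise l) ->
  exists k, piecewise k (-1) (left_wall ^~ G).
Proof.
move=> L0 hL; have [|k hk] := @seq_piecewise (left_options G)
    (fun t l => stop_right t l) 0.
  by move=> l lG; have [k [_ h]] := hL l lG; exists k.
exists k; apply: (piecewise_seq_max (f := fun t l => stop_right t l - t)) => // l lG.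
by apply: (piecewiseB_id (c := 0)); exact: hk.
Qed.

Lemma right_wall_piecewise G : right_options G != [::] ->
  (forall r, r \in right_options G -> stops_piecewise r) ->
  exists k, piecewise k 0 (right_wall ^~ G).
Proof.
move=> R0 hR; have [|k hk] := @seq_piecewise (right_options G)
    (fun t r => stop_left t r) (-1).
  by move=> r rG; have [k [h _]] := hR r rG; exists k.
exists k; apply: (piecewise_seq_min (f := fun t r => stop_left t r + t)) => // r rG.
by apply: (piecewiseD_id (c := -1)); exact: hk.
Qed.

Lemma walls_cross G : left_options G != [::] -> right_options G != [::] ->
  (forall l, l \in left_options G -> stops_spec l) ->
  (forall r, r \in right_options G -> stops_spec r) ->
  exists t, left_wall t G < right_wall t G.
Proof.
move=> L0 R0 hL hR.
have ub t : -1 <= t -> exists2 l, l \in left_options G &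
    left_wall t G <= stop_left (-1) l - t.
  move=> t1; have [x xG ->] := left_wall_ex t L0; exists x => //.
  have [mono _ _ /(_ t) le] := hL x xG; have [h _ _ _] := mono _ _ t1; lra.
have lb t : -1 <= t -> exists2 r, r \in right_options G &
    stop_right (-1) r + t <= right_wall t G.
  move=> t1; have [x xG ->] := right_wall_ex t R0; exists x => //.
  have [mono _ _ /(_ t) le] := hR x xG; have [_ _ h _] := mono _ _ t1; lra.
pose A := seq_max [seq stop_left (-1) x | x <- left_options G].
pose B := seq_min [seq stop_right (-1) x | x <- right_options G].
(* The left wall is at most [A - t] and the right wall at least [B + t], so [2 * t > A - B] is
   enough. *)
pose t := Num.max 0 (A - B + 1).
have t0 : 0 <= t by rewrite le_max lexx.
have t1 : -1 <= t by lra.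
have t2 : A - B + 1 <= t by rewrite le_max lexx orbT.
have [x xG xE] := ub t t1; have [y yG yE] := lb t t1.
have xA : stop_left (-1) x <= A by apply/seq_max_ge/mapP; exists x.
have yB : B <= stop_right (-1) y by apply/seq_min_le/mapP; exists y.
by exists t; lra.
Qed.

Lemma freezingP G : (forall n, val_of G <> num_value n%:~R) ->
  (forall l, l \in left_options G -> stops_spec l) ->
  (forall r, r \in right_options G -> stops_spec r) -> freezing_spec G.
Proof.
move=> nint hL hR.
have [L0 R0 lt1] : [/\ left_options G != [::], right_options G != [::] &
    right_wall (-1) G < left_wall (-1) G].
  by apply: walls_base => // x => [/hL[]|/hR[]].
have [t ltt] := walls_cross L0 R0 hL hR.
have lipL := left_wall_lip L0 (fun l lG => let: And4 h _ _ _ := hL l lG in h).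
have lipR := right_wall_lip R0 (fun r rG => let: And4 h _ _ _ := hR r rG in h).
have [k1 p1] := left_wall_piecewise L0 (fun l lG => let: And4 _ h _ _ := hL l lG in h).
have [k2 p2] := right_wall_piecewise R0 (fun r rG => let: And4 _ h _ _ := hR r rG in h).
have [j jE jmin] := piecewise_meet (piecewise_leq (leq_maxl k1 k2) p1)
  (piecewise_leq (leq_maxr k1 k2) p2) (fun y x xy => proj1 (andP (lipL x y xy)))
  (fun x y xy => proj1 (andP (lipR x y xy))) lt1 ltt.
(* Exhibiting a minimum rules out the default value of [set_min]. *)
have [[dy eqw] minw] : [set u | [set t | is_dyadic t /\
      left_wall t G = right_wall t G]%classic u /\
    forall v, [set t | is_dyadic t /\
      left_wall t G = right_wall t G]%classic v -> u <= v]%classic (freezing_temp G).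
  apply: xgetPex; exists (j%:~R * mesh (maxn k1 k2).+1).
  by do 2?split=> //; [exact: dyadic_mesh | move=> v /= [_ /jmin]].
split=> //; rewrite ltNge; apply/negP => le1.
have /andP[h1 _] := lipL _ _ le1; have /andP[h2 _] := lipR _ _ le1.
by move: lt1; rewrite ltNge => /negP[]; lra.
Qed.

Lemma stops_frozen t G : int_value G = None -> freezing_spec G ->
  stop_left t G = left_wall (Num.min t (freezing_temp G)) G /\
  stop_right t G = right_wall (Num.min t (freezing_temp G)) G.
Proof.
move=> Gn [_ eqw _ _ _]; rewrite stop_leftE // stop_rightE // eqw.
by case: (leP t (freezing_temp G)) => h; rewrite ?(min_l h) ?(min_r (ltW h)).
Qed.

(** One induction for all four properties: together, for the options, they give [G] a freezing
    temperature. The stops of [G] are then its walls at the smaller of [t] and that temperature, and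
    inherit the properties from the walls. *)
Lemma stops_specP G : stops_spec G.
Proof.
elim/game_option_ind: G => G hL hR.
case Gn: (int_value G) => [n|].
  have GE := int_value_some Gn.
  have lE t := stop_left_int t Gn; have rE t := stop_right_int t Gn.
  split.
  - by move=> s t st; rewrite !lE !rE; split; lra.
  - exists 0%N; split; under eq_fun do rewrite (lE, rE);
      by apply: piecewise_cst; auto.
  - exists n, n; rewrite lE rE; split=> //; first by rewrite GE lexx.
      by rewrite GE num_value_ler_int; lia.
    by rewrite GE num_value_ler_int; lia.
  - by move=> t; rewrite lE rE.
have nint := int_value_none Gn.
have fs := freezingP nint hL hR; have [dy eqw t1 L0 R0] := fs.
have stE t := stops_frozen t Gn fs.
have lipL := left_wall_lip L0 (fun l lG => let: And4 h _ _ _ := hL l lG in h).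
have lipR := right_wall_lip R0 (fun r rG => let: And4 h _ _ _ := hR r rG in h).
have baseL l (lG : l \in left_options G) := let: And4 _ _ h _ := hL l lG in h.
have baseR r (rG : r \in right_options G) := let: And4 _ _ h _ := hR r rG in h.
split.
- move=> s t st; have [-> ->] := stE s; have [-> ->] := stE t.
  set u := freezing_temp G.
  have st' : Num.min s u <= Num.min t u by rewrite le_min !ge_min st lexx orbT.
  have dst : Num.min t u - Num.min s u <= t - s.
    by case: (leP t u) => tu; case: (leP s u) => su; lra.
  have /andP[h1 h2] := lipL _ _ st'; have /andP[h3 h4] := lipR _ _ st'.
  by split; lra.
- have [k1 p1] := left_wall_piecewise L0 (fun l lG => let: And4 _ h _ _ := hL l lG in h).
  have [k2 p2] := right_wall_piecewise R0 (fun r rG => let: And4 _ h _ _ := hR r rG in h).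
  have [i on_mesh] := dyadic_on_mesh dy; pose k := maxn i (maxn k1 k2).
  have [j uE] := on_mesh k (leq_maxl _ _).
  have k1k : (k1 <= k)%N by rewrite /k; lia.
  have k2k : (k2 <= k)%N by rewrite /k; lia.
  exists k; split.
    have -> : stop_left ^~ G = fun t => if t <= freezing_temp G then
        left_wall t G else left_wall (freezing_temp G) G.
      by apply/funext => t; rewrite stop_leftE.
    by rewrite uE; apply: piecewise_freeze (piecewise_leq k1k p1); right.
  have -> : stop_right ^~ G = fun t => if t <= freezing_temp G then
      right_wall t G else right_wall (freezing_temp G) G.
    by apply/funext => t; rewrite stop_rightE // eqw.
  by rewrite uE; apply: piecewise_freeze (piecewise_leq k2k p2); left.
- have [a aE] := left_wall_base baseL; have [b bE] := right_wall_base baseR.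
  have [lE rE] := stE (-1); rewrite (min_l (ltW t1)) in lE rE.
  have ltba : b < a.
    by have [_ _] := walls_base baseL baseR nint; rewrite aE bE ltr_int.
  have [l lG lw] := left_wall_ex (-1) L0; have [r rG rw] := right_wall_ex (-1) R0.
  have [lx [rx [_ rxE /andP[rxl _] _ _]]] := baseL l lG.
  have [ly [ry [lyE _ /andP[_ rly] _ _]]] := baseR r rG.
  have aE' : a = rx + 1.
    by apply: (@intr_inj rat); rewrite -aE lw rxE intrD opprK.
  have bE' : b = ly - 1.
    by apply: (@intr_inj rat); rewrite -bE rw lyE intrB.
  have subL := left_wall_base_ub (n := a) baseL; rewrite aE lexx in subL.
  have subR := right_wall_base_lb (n := b) baseR; rewrite bE lexx in subR.
  have nlea : ~~ (val_of G <= num_value (a - 1)%:~R).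
    apply/negP => lea; move/negP: (val_left_option lG); apply.
    by apply: le_trans lea _; rewrite (_ : a - 1 = rx) //; lia.
  have nleb : ~~ (num_value (b + 1)%:~R <= val_of G).
    apply/negP => leb; move/negP: (val_right_option rG); apply.
    by apply: le_trans rly _; rewrite (_ : ly = b + 1) //; lia.
  have ltba' : b%:~R <= (a - 1)%:~R :> rat by rewrite ler_int; lia.
  have ltba'' : (b + 1)%:~R <= a%:~R :> rat by rewrite ler_int; lia.
  (* Moves in [G] are excluded by the walls. Moves in the integers [b] and [a] lead below [b] or
     above [a], where [nlea] and [nleb] exclude them because [b + 1 <= a]. *)
  exists a, b; rewrite lE rE; split=> //; apply/andP; split; apply/val_leP.
    split=> [x /(num_game_left (dyadic_int b))[y [dy' yb] ->]|]; last exact: subR.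
    apply: contra nlea => /le_trans; apply; rewrite num_value_le //; first lra.
    exact: dyadic_int.
  split=> [|x /(num_game_right (dyadic_int a))[y [dy' ya] ->]]; first exact: subL.
  apply: contra nleb; apply: le_trans; rewrite num_value_le //; first lra.
  exact: dyadic_int.
- move=> t; have [-> ->] := stE t; set u := freezing_temp G.
  have mu : Num.min t u <= u by rewrite ge_min lexx orbT.
  have /andP[h1 _] := lipL _ _ mu; have /andP[h2 _] := lipR _ _ mu.
  by rewrite /u in h1 h2 *; lra.
Qed.

(** * Hot games *)

Lemma freezing_specP G : int_value G = None -> freezing_spec G.
Proof.
by move=> /int_value_none nint; apply: freezingP => // *; exact: stops_specP.
Qed.

Lemma stop_left_dyadic t G : is_dyadic t -> is_dyadic (stop_left t G).
Proof.
by have [_ [k [h _]] _ _] := stops_specP G; exact: (piecewise_dyadic h).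
Qed.

Lemma frozen_value_dyadic G :
  int_value G = None -> is_dyadic (left_wall (freezing_temp G) G).
Proof.
move=> Gn; have [dy _ _ _ _] := freezing_specP Gn.
by have := stop_left_dyadic G dy; rewrite stop_leftE // lexx.
Qed.

Lemma num_value_inj x y :
  is_dyadic x -> is_dyadic y -> num_value x = num_value y -> x = y.
Proof.
by move=> dx dy xy; apply/eqP; rewrite eq_le -!num_value_le // xy lexx.
Qed.

Lemma int_valueN G : int_value (- G) = omap -%R (int_value G).
Proof.
case Gn: (int_value G) => [n|] /=; case Nn: (int_value (- G)) => [m|] //.
- congr Some; apply: (@intr_inj rat); apply: num_value_inj.
  + exact: dyadic_int.
  + exact: dyadic_int.
  rewrite -(int_value_some Nn) val_ofN (int_value_some Gn) intrN num_valueN //.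
  exact: dyadic_int.
- case: (@int_value_none _ Nn (- n)).
  rewrite val_ofN (int_value_some Gn) intrN num_valueN //; exact: dyadic_int.
case: (@int_value_none _ Gn (- m)); rewrite intrN num_valueN; last exact: dyadic_int.
by rewrite -(int_value_some Nn) val_ofN opprK.
Qed.

Lemma thermograph_opp G : [/\ forall t, stop_left t (- G) = - stop_right t G,
  forall t, stop_right t (- G) = - stop_left t G &
  forall t, cool t (- G) = (- cool t G)%game].
Proof.
elim/game_option_ind: G => G hL hR.
case Gn: (int_value G) => [n|].
  have Nn := int_valueN G; rewrite Gn /= in Nn.
  split=> t; rewrite ?(stop_left_int t Gn) ?(stop_right_int t Gn) ?(cool_int t Gn).
  - by rewrite (stop_left_int t Nn) intrN.
  - by rewrite (stop_right_int t Nn) intrN.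
  by rewrite (cool_int t Nn) int_gameN.
have Nn := int_valueN G; rewrite Gn /= in Nn.
have lw t : left_wall t (- G) = - right_wall t G.
  rewrite /left_wall /right_wall seq_minN opprK left_options_opp -!map_comp.
  by congr seq_max; apply/eq_in_map => r /hR[_ /(_ t) /= -> _]; rewrite opprD.
have rw t : right_wall t (- G) = - left_wall t G.
  rewrite /left_wall /right_wall seq_minN right_options_opp -!map_comp.
  congr (- seq_max _); apply/eq_in_map => l /hL[/(_ t) /= -> _ _].
  by rewrite opprD opprK.
have tE : freezing_temp (- G) = freezing_temp G.
  congr set_min; apply/seteqP; split=> t [dt]; rewrite ?lw ?rw => h; split=> //.
    by move/oppr_inj: h.
  by rewrite lw rw h.
have [dy eqw _ _ _] := freezing_specP Gn.
split=> t.
- by rewrite stop_leftE // stop_rightE // tE !lw eqw; case: ifP.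
- by rewrite stop_leftE // stop_rightE // tE !lw !rw eqw; case: ifP.
rewrite !coolE // tE lw -eqw; case: ifP => _; last first.
  by rewrite num_gameN //; exact: frozen_value_dyadic.
apply: game_ext; rewrite /raw_cool /=.
  rewrite left_options_opp -!map_comp; apply/eq_in_map => r /hR[_ _ /(_ t) /= ->].
  by rewrite game_oppD.
rewrite right_options_opp -!map_comp; apply/eq_in_map => l /hL[_ _ /(_ t) /= ->].
by rewrite game_oppD game_oppK.
Qed.

(** The left wall is at or above the right wall, said without naming the walls. The room between [x]
    and [y] absorbs infinitesimals, and the condition makes sense for sums of cooled games, for
    which no stops are computed. A game such as [{0 | 0}] qualifies. *)
Definition hot G := forall x y, is_dyadic x -> is_dyadic y -> x < y ->
  (exists2 l, l \in left_options G & num_value x <= val_of l) \/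
  (exists2 r, r \in right_options G & val_of r <= num_value y).

Lemma hotN G : hot G -> hot (- G).
Proof.
move=> hG x y dx dy xy; have [||] := hG _ _ (dyadicN dy) (dyadicN dx).
- by rewrite ltrN2.
- case=> l lG le; right; exists (- l)%game.
    by rewrite right_options_opp; apply/mapP; exists l.
  by rewrite val_ofN -[num_value y]opprK value_leN2 -num_valueN.
case=> r rG le; left; exists (- r)%game.
  by rewrite left_options_opp; apply/mapP; exists r.
by rewrite val_ofN -[num_value x]opprK value_leN2 -num_valueN.
Qed.

(** Number avoidance: a move in the number [- z] cannot help Left in [G - z]. *)
Lemma hot_le_num G z : hot G -> is_dyadic z ->
  (forall l, l \in left_options G -> ~~ (num_value z <= val_of l)) ->
  val_of G <= num_value z.
Proof.
move=> hG dz hL; apply/val_leP; split=> // r /(num_game_right dz)[y [dy zy] ->].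
apply/negP => leyG; have [] := hG z y dz dy zy.
  by case=> l lG lel; move/negP: (hL l lG).
case=> s sG les; move/negP: (val_right_option sG); apply.
exact: le_trans les leyG.
Qed.

Lemma hot_ge_num G z : hot G -> is_dyadic z ->
  (forall r, r \in right_options G -> ~~ (val_of r <= num_value z)) ->
  num_value z <= val_of G.
Proof.
move=> hG dz hR; rewrite -value_leN2 -num_valueN // -val_ofN.
apply: hot_le_num (hotN hG) (dyadicN dz) _ => l.
rewrite left_options_opp => /mapP[r rG ->].
by rewrite val_ofN num_valueN // value_leN2; exact: hR.
Qed.

Lemma num_value_bounds G : exists i j : int,
  num_value i%:~R <= val_of G /\ val_of G <= num_value j%:~R.
Proof.
by have [_ _ [j [i [_ _ /andP[le1 le2] _ _]]] _] := stops_specP G; exists i, j.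
Qed.

(** Finds the left wall up to an error [d]: [x] is a multiple of [d] that some Left option reaches
    while none reaches [x + d], and number avoidance then bounds [G] by [x + d]. *)
Lemma hot_left_wall G d : hot G -> is_dyadic d -> 0 < d ->
  exists2 x, is_dyadic x /\ val_of G <= num_value (x + d) &
    exists2 l, l \in left_options G & num_value x <= val_of l.
Proof.
move=> hG dd d0; have [i [j [leiG leGj]]] := num_value_bounds G.
pose P (n : int) := exists2 l, l \in left_options G &
  num_value (n%:~R * d) <= val_of l.
have [n0 n0i _] := floor_multiple (i%:~R - 1) d0.
have [n1 _ jn1] := floor_multiple j%:~R d0.
(* Starting from [i - 1] puts [n0 * d] strictly below [i]; the alternative offered by [hot], a Right
   option at or below [i], is impossible since [i <= G]. *)
have P0 : P n0.
  have [||||[r rG ler]] := hG (n0%:~R * d) i%:~R.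
  - exact: dyadicM_int.
  - exact: dyadic_int.
  - lra.
  - by [].
  by move/negP: (val_right_option rG); case; apply: le_trans leiG.
have P1 : ~ P (n1 + 1).
  case=> l lG lel; move/negP: (val_left_option lG); apply.
  apply: le_trans leGj _; apply: le_trans lel; rewrite num_value_le //.
    exact: dyadic_int.
  exact: dyadicM_int.
have n01 : n0 <= n1 + 1.
  rewrite leNgt; apply/negP => lt; case: P0 => l lG lel.
  apply: P1; exists l => //; apply: le_trans lel; rewrite num_value_le.
  - by rewrite ler_pM2r // ler_int ltW.
  - exact: dyadicM_int.
  - exact: dyadicM_int.
have [n Pn nPn] := int_last n01 P0 P1; exists (n%:~R * d) => //.
have -> : n%:~R * d + d = (n + 1)%:~R * d by rewrite intrD mulrDl mul1r.
split; first exact: dyadicM_int.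
apply: hot_le_num => // [|l lG]; first exact: dyadicM_int.
by apply/negP => lel; apply: nPn; exists l.
Qed.

Lemma hot_right_wall G d : hot G -> is_dyadic d -> 0 < d ->
  exists2 x, is_dyadic x /\ num_value (x - d) <= val_of G &
    exists2 r, r \in right_options G & val_of r <= num_value x.
Proof.
move=> hG dd d0; have [x [dx leGx] [l]] := hot_left_wall (hotN hG) dd d0.
rewrite left_options_opp => /mapP[r rG ->] lel; exists (- x).
  split; first exact: dyadicN.
  rewrite -opprD num_valueN; last exact: dyadicD.
  by rewrite -value_leN2 opprK -val_ofN.
by exists r => //; rewrite num_valueN // -value_leN2 opprK -val_ofN.
Qed.

(** Milnor's argument: Left plays in the first summand, Right in the second. *)
Lemma hot_add G H : hot G -> hot H -> hot (G + H).
Proof.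
move=> hG hH x y dx dy xy; pose d := (y - x) / 2%:R ^+ 1.
have dd : is_dyadic d by apply: dyadic_div; exact: dyadicB.
have d0 : 0 < d by rewrite /d expr1; lra.
have [a [da Ga] [l lG al]] := hot_left_wall hG dd d0.
have [b [db bH] [r rH rb]] := hot_right_wall hH dd d0.
(* Left's move gives at least [a + (b - d)], Right's at most [(a + d) + b]. These bounds differ by
   [2 * d = y - x], so one of the moves is good enough. *)
have [lex|ltx] := leP x (a + b - d).
  left; exists (l + H)%game; first exact: mem_left_addl.
  rewrite val_ofD; apply: (@le_trans _ _ (num_value (a + (b - d)))).
    by rewrite num_value_le; [lra|done|apply/dyadicD/dyadicB].
  by rewrite num_valueD //; [exact: value_leD | exact: dyadicB].
right; exists (G + r)%game; first exact: mem_right_addr.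
rewrite val_ofD; apply: (@le_trans _ _ (num_value (a + d + b))).
  by rewrite num_valueD //; [exact: value_leD | exact: dyadicD].
rewrite num_value_le //; first by move: ltx; rewrite /d expr1; lra.
by apply: dyadicD => //; exact: dyadicD.
Qed.

(** * Cooled games *)

Definition unfrozen t G := (int_value G == None) && (t <= freezing_temp G).

Lemma cool_unfrozen t G : unfrozen t G -> [/\ cool t G = raw_cool t G,
  stop_left t G = left_wall t G & stop_right t G = right_wall t G].
Proof.
by move=> /andP[/eqP Gn tG]; rewrite coolE // stop_leftE // stop_rightE // tG.
Qed.

Lemma cool_frozen t G : ~~ unfrozen t G ->
  val_of (cool t G) = num_value (stop_left t G) /\
  stop_right t G = stop_left t G.
Proof.
rewrite negb_and; case Gn: (int_value G) => [n|] /=.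
  rewrite (cool_int t Gn) (stop_left_int t Gn) (stop_right_int t Gn) => _.
  by rewrite num_value_int.
by move=> /negbTE tG; rewrite coolE // stop_leftE // stop_rightE // tG.
Qed.

Lemma unfrozen_leq s t G : s <= t -> unfrozen t G -> unfrozen s G.
Proof. by move=> st /andP[Gn tG]; rewrite /unfrozen Gn (le_trans st tG). Qed.

Lemma unfrozen_options t G : unfrozen t G ->
  left_options G != [::] /\ right_options G != [::].
Proof. by case/andP => /eqP /freezing_specP[]. Qed.

Lemma raw_cool_left t G x : x \in left_options (raw_cool t G) ->
  exists2 l, l \in left_options G & val_of x = val_of (cool t l) - num_value t.
Proof.
by case/mapP=> l lG ->; exists l => //; rewrite val_ofD val_ofN.
Qed.

Lemma raw_cool_right t G x : x \in right_options (raw_cool t G) ->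
  exists2 r, r \in right_options G & val_of x = val_of (cool t r) + num_value t.
Proof. by case/mapP=> r rG ->; exists r => //; rewrite val_ofD. Qed.

Lemma mem_raw_cool_left t G l : l \in left_options G ->
  exists2 x, x \in left_options (raw_cool t G) &
    val_of x = val_of (cool t l) - num_value t.
Proof.
move=> lG; exists (cool t l - num_game t)%game; last by rewrite val_ofD val_ofN.
by apply/mapP; exists l.
Qed.

Lemma mem_raw_cool_right t G r : r \in right_options G ->
  exists2 x, x \in right_options (raw_cool t G) &
    val_of x = val_of (cool t r) + num_value t.
Proof.
move=> rG; exists (cool t r + num_game t)%game; last by rewrite val_ofD.
by apply/mapP; exists r.
Qed.

(** The recursively computed stops are the stops of the cooled game. When [d] equals a stop the
    comparison may depend on an infinitesimal, hence the strict hypotheses. *)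
Definition cool_stops t G := forall d, is_dyadic d ->
  [/\ d < stop_right t G -> num_value d <= val_of (cool t G),
      stop_right t G < d -> ~~ (num_value d <= val_of (cool t G)),
      stop_left t G < d -> val_of (cool t G) <= num_value d &
      d < stop_left t G -> ~~ (val_of (cool t G) <= num_value d)].

(** Up to freezing the left wall is not below the right one, so either [x] lies under the left wall
    or [y] above the right wall. The property of the options is assumed here because the lemma
    serves inside the induction that proves it. *)
Lemma cool_hot_of_stops t G : is_dyadic t -> unfrozen t G ->
  (forall l, l \in left_options G -> cool_stops t l) ->
  (forall r, r \in right_options G -> cool_stops t r) -> hot (cool t G).
Proof.
move=> dt uG hL hR x y dx dy xy; have [-> lE rE] := cool_unfrozen uG.
have [L0 R0] := unfrozen_options uG; have [_ _ _ /(_ t)] := stops_specP G.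
rewrite lE rE => rl; have [ltx|lex] := ltP x (left_wall t G).
  left; have [l lG lw] := left_wall_ex t L0.
  have [z zG zE] := mem_raw_cool_left t lG; exists z => //.
  rewrite zE value_leBrDr -num_valueD //.
  by have [h _ _ _] := hL l lG _ (dyadicD dx dt); apply: h; lra.
right; have [r rG rw] := right_wall_ex t R0.
have [z zG zE] := mem_raw_cool_right t rG; exists z => //.
rewrite zE -value_leBrDr -num_valueB //.
by have [_ _ h _] := hR r rG _ (dyadicB dy dt); apply: h; lra.
Qed.

Lemma cool_stopsP t G : is_dyadic t -> cool_stops t G.
Proof.
move=> dt; elim/game_option_ind: G => G hL hR d dd.
have [uG|fG] := boolP (unfrozen t G); last first.
  have [-> ->] := cool_frozen fG; have ds := stop_left_dyadic G dt.
  by rewrite !num_value_le //; split; rewrite -?ltNge //; exact: ltW.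
have hG := cool_hot_of_stops dt uG hL hR; have [cE lE rE] := cool_unfrozen uG.
have [L0 R0] := unfrozen_options uG; rewrite lE rE.
split=> ltd.
- apply: hot_ge_num => // x; rewrite cE => /raw_cool_right[r rG ->].
  rewrite -value_leBrDr -num_valueB //.
  have [_ _ _ h] := hR r rG _ (dyadicB dd dt); apply: h.
  by have := right_wall_le t rG; lra.
- have [r rG rw] := right_wall_ex t R0; have [x xG xE] := mem_raw_cool_right t rG.
  rewrite -cE in xG; apply: contra (val_right_option xG); apply: le_trans.
  rewrite xE -value_leBrDr -num_valueB //.
  by have [_ _ h _] := hR r rG _ (dyadicB dd dt); apply: h; lra.
- apply: hot_le_num => // x; rewrite cE => /raw_cool_left[l lG ->].
  rewrite value_leBrDr -num_valueD //.
  have [_ h _ _] := hL l lG _ (dyadicD dd dt); apply: h.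
  by have := left_wall_ge t lG; lra.
have [l lG lw] := left_wall_ex t L0; have [x xG xE] := mem_raw_cool_left t lG.
rewrite -cE in xG; apply: contra (val_left_option xG) => /le_trans; apply.
rewrite xE value_leBrDr -num_valueD //.
by have [h _ _ _] := hL l lG _ (dyadicD dd dt); apply: h; lra.
Qed.

Lemma cool_hot t G : is_dyadic t -> unfrozen t G -> hot (cool t G).
Proof. by move=> dt uG; apply: cool_hot_of_stops => // x _; exact: cool_stopsP. Qed.

(** The right stop grows at rate at most 1 and is constant after freezing, so a frozen stretch just
    before [t] makes the bound strict. *)
Lemma stop_frozen s t G : s < t -> ~~ unfrozen t G ->
  stop_right t G < stop_right s G + (t - s).
Proof.
move=> st; rewrite negb_and; case Gn: (int_value G) => [n|] /=.
  by rewrite !(stop_right_int _ Gn); lra.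
rewrite -ltNge => ltG; have fs := freezing_specP Gn.
set u := Num.max s (freezing_temp G).
have ut : u < t by rewrite /u gt_max st.
have su : s <= u by rewrite /u le_max lexx.
have uG : freezing_temp G <= u by rewrite /u le_max lexx orbT.
have [mono _ _ _] := stops_specP G; have [_ _ _ h] := mono _ _ su.
have -> : stop_right t G = stop_right u G; last lra.
have [_ ->] := stops_frozen t Gn fs; have [_ ->] := stops_frozen u Gn fs.
by rewrite !min_r // ltW.
Qed.

(** At [t] itself the stops only determine [cool t] up to infinitesimals; the
    bounds become exact when the inequality between stops already holds at some
    earlier temperature [s]. *)
Lemma cool_stop_exact s t G : is_dyadic t -> s < t -> forall x, is_dyadic x ->
  (stop_right s G <= x + s -> ~~ (num_value (x + t) <= val_of (cool t G))) /\
  (stop_left s G <= x -> val_of (cool t G) <= num_value x).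
Proof.
move=> dt st; elim/game_option_ind: G => G hL hR x dx.
have dxt := dyadicD dx dt.
have [uG|fG] := boolP (unfrozen t G); last first.
  have [-> rlE] := cool_frozen fG; have ds := stop_left_dyadic G dt.
  rewrite !num_value_le // -ltNge; split=> le.
    by have := stop_frozen st fG; rewrite rlE; lra.
  by have [mono _ _ _] := stops_specP G; have [h _ _ _] := mono _ _ (ltW st); lra.
(* The two halves feed each other with the same [x]: passing to an option changes the stop at [s] by
   the tax [s] and the cooled value by the tax [t], exactly as the two bounds prescribe. *)
have [L0 R0] := unfrozen_options uG; have [cE _ _] := cool_unfrozen uG.
have [_ -> ->] := cool_unfrozen (unfrozen_leq (ltW st) uG); split=> le.
  have [r rG rw] := right_wall_ex s R0; have [y yG yE] := mem_raw_cool_right t rG.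
  rewrite -cE in yG; apply: contra (val_right_option yG); apply: le_trans.
  rewrite yE num_valueD // value_leD2r.
  by have [_ h] := hR r rG x dx; apply: h; lra.
apply: hot_le_num => // [|y]; first exact: cool_hot.
rewrite cE => /raw_cool_left[l lG ->].
rewrite value_leBrDr -num_valueD //.
by have [h _] := hL l lG x dx; apply: h; have := left_wall_ge s lG; lra.
Qed.

(** After tax, [l] behaves like a Left option of the cooled game even when [G] is frozen and its
    cooled form has no such option. This is all that the main induction needs to know about Left's
    reply. *)
Lemma cool_left_option t G l : is_dyadic t -> -1 < t -> l \in left_options G ->
  ~~ (val_of (cool t G) + num_value t <= val_of (cool t l)).
Proof.
move=> dt t1 lG; have [uG|fG] := boolP (unfrozen t G).
  have [cE _ _] := cool_unfrozen uG; have [x xG xE] := mem_raw_cool_left t lG.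
  by rewrite -cE in xG; have := val_left_option xG; rewrite xE value_leBrDr.
have ds := stop_left_dyadic G dt.
have [-> _] := cool_frozen fG; rewrite -num_valueD //.
case Gn: (int_value G) => [n|].
  rewrite (stop_left_int t Gn).
  (* The earlier temperature is -1. There the right stop of [l] is an integer [r <= l], and [n <= r]
     would put [G] at or below its own Left option. *)
  have [h _] := cool_stop_exact l dt t1 (dyadic_int n); apply: h.
  have [_ _ [_ [r [_ -> /andP[lel _] _ _]]] _] := stops_specP l.
  rewrite -[-1]/((-1)%:~R) -intrD ler_int.
  suff : ~~ (n <= r) by lia.
  apply: contra (val_left_option lG); rewrite -num_value_ler_int => lenr.
  by rewrite (int_value_some Gn); apply: le_trans lel.
move: fG; rewrite negb_and Gn /= -ltNge => ltt.
rewrite stop_leftE // leNgt ltt /=.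
have [h _] := cool_stop_exact l dt ltt (frozen_value_dyadic Gn); apply: h.
by have := left_wall_ge (freezing_temp G) lG; lra.
Qed.

(** * Sums of several games and the main induction *)

Definition game_sum (s : seq game) := foldr game_add zero_game s.

Lemma val_game_sum s : val_of (game_sum s) = \sum_(g <- s) val_of g.
Proof.
elim: s => [|g s IH]; first by rewrite big_nil.
by rewrite big_cons -IH val_ofD.
Qed.

Lemma game_sum_left s x : x \in left_options (game_sum s) ->
  exists2 h, h \in s & exists2 l, l \in left_options h &
    val_of x = val_of l + \sum_(g <- rem h s) val_of g.
Proof.
elim: s x => // g s IH x /mem_left_add[[l lg ->]|[y /IH[h hs [l lh yE]] ->]].
  exists g; first exact: mem_head.
  by exists l => //; rewrite val_ofD val_game_sum /= eqxx.
exists h; first by rewrite inE hs orbT.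
exists l => //; rewrite val_ofD yE addrCA /=; case: eqP => [->|_].
  by rewrite [X in _ = _ + X](big_rem h).
by rewrite big_cons.
Qed.

Lemma game_sum_right s x : x \in right_options (game_sum s) ->
  exists2 h, h \in s & exists2 r, r \in right_options h &
    val_of x = val_of r + \sum_(g <- rem h s) val_of g.
Proof.
elim: s x => // g s IH x /mem_right_add[[l lg ->]|[y /IH[h hs [l lh yE]] ->]].
  exists g; first exact: mem_head.
  by exists l => //; rewrite val_ofD val_game_sum /= eqxx.
exists h; first by rewrite inE hs orbT.
exists l => //; rewrite val_ofD yE addrCA /=; case: eqP => [->|_].
  by rewrite [X in _ = _ + X](big_rem h).
by rewrite big_cons.
Qed.

Lemma hot_game_sum s : s != [::] -> (forall g, g \in s -> hot g) ->
  hot (game_sum s).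
Proof.
elim: s => // g [|h s] IH _ hs; first by rewrite /= game_add0; exact/hs/mem_head.
apply: hot_add; first exact/hs/mem_head.
by apply: IH => // x xs; apply: hs; rewrite inE xs orbT.
Qed.

Lemma left_winning_move s : ~~ (\sum_(g <- s) val_of g <= 0) ->
  exists2 h, h \in s & exists2 l, l \in left_options h &
    0 <= val_of l + \sum_(g <- rem h s) val_of g.
Proof.
rewrite -val_game_sum => nle.
have [/hasP[x /game_sum_left[h hs [l lh xE]] x0]|/hasPn nox] :=
    boolP (has (fun x => 0 <= val_of x) (left_options (game_sum s))).
  by exists h => //; exists l => //; rewrite -xE.
by case/negP: nle; apply/val_leP.
Qed.

Lemma dyadic_sum (s : seq game) (P : pred game) (f : game -> rat) :
  (forall g, is_dyadic (f g)) -> is_dyadic (\sum_(g <- s | P g) f g).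
Proof.
move=> df; elim/big_ind: _ => [|x y dx dy|g _]; last exact: df.
  exact: (dyadic_int 0).
exact: dyadicD.
Qed.

Lemma num_value_sum (s : seq game) (P : pred game) (f : game -> rat) :
  (forall g, is_dyadic (f g)) ->
  num_value (\sum_(g <- s | P g) f g) = \sum_(g <- s | P g) num_value (f g).
Proof.
move=> df; elim: s => [|g s IH]; first by rewrite !big_nil num_value0.
rewrite !big_cons; case: ifP => // _; rewrite num_valueD ?IH //.
exact: dyadic_sum.
Qed.

(** Right's move shifts the cooled sum by [+t] and Left's reply by [-t]. What results is again an
    untaxed sum of cooled games, of smaller total size, to which the induction hypothesis
    applies. *)
Lemma cool_sum_step n t s : is_dyadic t -> -1 < t ->
  (forall s', (\sum_(g <- s') game_size g < n)%N ->
    0 <= \sum_(g <- s') val_of g -> 0 <= \sum_(g <- s') val_of (cool t g)) ->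
  (\sum_(g <- s) game_size g <= n)%N -> has (unfrozen t) s ->
  0 <= \sum_(g <- s) val_of g -> 0 <= \sum_(g <- s) val_of (cool t g).
Proof.
move=> dt t1 IH sz hs s0; pose u := filter (unfrozen t) s.
pose Y := game_sum (map (cool t) u).
pose z := \sum_(g <- s | ~~ unfrozen t g) stop_left t g.
have dz : is_dyadic z by apply: dyadic_sum => g; exact: stop_left_dyadic.
have SE : \sum_(g <- s) val_of (cool t g) = val_of Y + num_value z.
  rewrite (bigID (unfrozen t)) /= val_game_sum big_map big_filter; congr (_ + _).
  rewrite num_value_sum => [|g]; last exact: stop_left_dyadic.
  by apply: eq_bigr => g /cool_frozen[].
have hY : hot Y.
  apply: hot_game_sum => [|x /mapP[g]].
    by move: hs; rewrite has_filter -/u; case: (u).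
  by rewrite mem_filter => /andP[ug _] ->; exact: cool_hot.
rewrite SE -value_leBlDr sub0r -num_valueN //.
apply: hot_ge_num (dyadicN dz) _ => // x /game_sum_right[_ /mapP[g gu ->]].
move: (gu); rewrite mem_filter => /andP[ug gs] [r'].
have [cE _ _] := cool_unfrozen ug; rewrite cE => /raw_cool_right[r rg r'E] xE.
rewrite -cE in xE; apply/negP => lex.
pose T := \sum_(h <- rem g s) val_of (cool t h).
have le0 : val_of (cool t r) + T + num_value t <= 0.
  rewrite -(value_leD2r (num_value (- z))) add0r; apply: le_trans lex.
  have YE : \sum_(h <- rem (cool t g) (map (cool t) u)) val_of h = T - num_value z.
    apply: (addrI (val_of (cool t g))).
    have TE : val_of (cool t g) + T = val_of Y + num_value z.
      by rewrite -SE [RHS](big_rem g).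
    rewrite addrA TE addrK val_game_sum [RHS](big_rem (cool t g)) //.
    by apply/mapP; exists g.
  by rewrite xE YE r'E num_valueN // addrA [X in _ <= X - _]addrAC lexx.
(* One move of Right from an uncooled sum [>= 0] cannot reach a value [<= 0], so Left has a winning
   reply. It may be in [r] itself or in any other summand, frozen or not. *)
have nle : ~~ (\sum_(h <- r :: rem g s) val_of h <= 0).
  rewrite big_cons; apply: contra (val_right_option rg) => le.
  rewrite -(value_leD2r (\sum_(h <- rem g s) val_of h)).
  by apply: le_trans le _; move: s0; rewrite (big_rem g).
have [h hs' [l lh l0]] := left_winning_move nle.
have szs' : (\sum_(x <- r :: rem g s) game_size x < n)%N.
  apply: leq_trans sz; rewrite big_cons [X in (_ < X)%N](big_rem g) //=.
  by rewrite ltn_add2r right_option_size.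
have szl : (\sum_(x <- l :: rem h (r :: rem g s)) game_size x < n)%N.
  apply: leq_trans szs'; rewrite ltnS big_cons [X in (_ <= X)%N](big_rem h) //.
  by rewrite leq_add2r ltnW // left_option_size.
have := IH _ szl; rewrite !big_cons => /(_ l0) cl0.
(* By [le0] the cooled [h] plus [t] plus the rest is [<= 0], while the cooled [l] plus the same rest
   is [>= 0]; cancelling the rest gives the forbidden inequality. *)
move/negP: (cool_left_option dt t1 lh); apply.
rewrite -(value_leD2r (\sum_(x <- rem h (r :: rem g s)) val_of (cool t x))).
apply: le_trans cl0; rewrite addrAC; move: le0; rewrite -/T.
have -> : val_of (cool t r) + T = \sum_(x <- r :: rem g s) val_of (cool t x).
  by rewrite big_cons.
by rewrite (big_rem h).
Qed.

Lemma value_le_sum (s : seq game) (F1 F2 : game -> game_value) :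
  (forall g, g \in s -> F1 g <= F2 g) ->
  \sum_(g <- s) F1 g <= \sum_(g <- s) F2 g.
Proof.
move=> leF; rewrite !big_seq.
by elim/big_ind2: _ => // *; exact: value_leD.
Qed.

(** If every summand is frozen at [t], lower the temperature to the largest
    freezing temperature: there some summand is still unfrozen, while the sum of
    cooled values changes only by an infinitesimal. *)
Lemma cool_sum_frozen t u s : is_dyadic t -> is_dyadic u -> u <= t ->
  ~~ has (unfrozen t) s ->
  (forall g, g \in s -> int_value g = None -> freezing_temp g <= u) ->
  0 <= \sum_(g <- s) val_of (cool u g) -> 0 <= \sum_(g <- s) val_of (cool t g).
Proof.
move=> dt du ut /hasPn ns tmp_u u0; set z := \sum_(g <- s) stop_left t g.
have dz : is_dyadic z by apply: dyadic_sum => g; exact: stop_left_dyadic.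
have -> : \sum_(g <- s) val_of (cool t g) = num_value z.
  rewrite num_value_sum => [|g]; last exact: stop_left_dyadic.
  by apply: eq_big_seq => g /ns/cool_frozen[].
rewrite -num_value0 num_value_le //; last exact: (dyadic_int 0).
have stE g : g \in s -> stop_left u g = stop_left t g.
  move=> gs; case Gn: (int_value g) => [n|].
    by rewrite !(stop_left_int _ Gn).
  have fs := freezing_specP Gn; have gu := tmp_u g gs Gn.
  have [-> _] := stops_frozen u Gn fs; have [-> _] := stops_frozen t Gn fs.
  by rewrite !min_r // (le_trans gu).
(* Raising every stop by [d] absorbs the infinitesimals at temperature [u]. The power of two keeps
   [d] dyadic and exceeds the number of summands, so the raised total is still negative. *)
rewrite leNgt; apply/negP => z0; pose d := - z / 2%:R ^+ size s.
have dd : is_dyadic d by apply/dyadic_div/dyadicN.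
have d0 : 0 < d by rewrite divr_gt0 ?pow2_gt0 // oppr_gt0.
have dst g : is_dyadic (stop_left t g + d).
  by apply: dyadicD dd; exact: stop_left_dyadic.
have : 0 <= num_value (\sum_(g <- s) (stop_left t g + d)).
  rewrite num_value_sum //; apply: le_trans u0 _; apply: value_le_sum => g gs.
  have [_ _ h _] := @cool_stopsP u g du _ (dst g); apply: h.
  by rewrite stE // ltrDl.
rewrite -num_value0 num_value_le //; first last.
- exact: dyadic_sum.
- exact: (dyadic_int 0).
rewrite big_split /= -/z big_const_seq count_predT iter_addr_0 -mulr_natl.
apply/negP; rewrite -ltNge /d.
have lt2 : (size s)%:R < 2%:R ^+ size s :> rat by rewrite -natrX ltr_nat ltn_expl.
have -> : z + (size s)%:R * (- z / 2%:R ^+ size s) =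
  z * ((2%:R ^+ size s - (size s)%:R) / 2%:R ^+ size s).
  by field; rewrite expf_neq0.
by rewrite nmulr_rlt0 // divr_gt0 ?pow2_gt0 // subr_gt0.
Qed.

Lemma cool_sum_ge0 t s : is_dyadic t -> -1 < t ->
  0 <= \sum_(g <- s) val_of g -> 0 <= \sum_(g <- s) val_of (cool t g).
Proof.
have [n] := ubnP (\sum_(g <- s) game_size g)%N.
elim: n t s => // n IH t s; rewrite ltnS => sz dt t1 s0.
have step u : is_dyadic u -> -1 < u -> has (unfrozen u) s ->
    0 <= \sum_(g <- s) val_of (cool u g).
  by move=> du u1 us; apply: (cool_sum_step (n := n)) => // s' szs'; exact: IH.
have [us|ns] := boolP (has (unfrozen t) s); first exact: step.
pose nonint := [seq g <- s | int_value g == None].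
(* If all summands are integers there is no temperature to descend to, but then cooling changes no
   value. *)
have [n0|n0] := eqVneq nonint [::].
  move: s0; congr (_ <= _); apply: eq_big_seq => g gs.
  case Gn: (int_value g) => [m|].
    by rewrite (cool_int t Gn) (int_value_some Gn) num_value_int.
  have : g \in nonint by rewrite mem_filter Gn.
  by rewrite n0.
pose u := seq_max [seq freezing_temp g | g <- nonint].
have : u \in [seq freezing_temp g | g <- nonint].
  by apply: seq_max_in; case: (nonint) n0.
case/mapP => g; rewrite mem_filter => /andP[/eqP Gn gs] uE.
have [du _ u1 _ _] := freezing_specP Gn; rewrite -uE in du u1.
have ut : u < t.
  by move/hasPn/(_ g gs): ns; rewrite negb_and Gn /= -ltNge -uE.
apply: (cool_sum_frozen dt du (ltW ut) ns) => [h hs Hn|].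
  by apply/seq_max_ge/mapP; exists h => //; rewrite mem_filter Hn.
by apply: step => //; apply/hasP; exists g => //; rewrite /unfrozen Gn uE /=.
Qed.

Lemma val_coolN t G : val_of (cool t (- G)) = - val_of (cool t G).
Proof. by have [_ _ ->] := thermograph_opp G; rewrite val_ofN. Qed.

Theorem theorem12 (t : rat) (ht : is_dyadic t) (ht1 : -1 < t) (G H : game) :
  (cool t (G + H) =v cool t G + cool t H)%game.
Proof.
have le_cool A B : val_of (cool t (A + B)) <= val_of (cool t A + cool t B).
  have := @cool_sum_ge0 t [:: A; B; - (A + B)]%game ht ht1.
  rewrite !big_cons !big_nil !addr0 val_coolN !val_ofN !val_ofD addrA subrr.
  by move=> /(_ (lexx _)); rewrite addrA value_leBrDr add0r.
apply/val_ofP/eqP; rewrite eq_le le_cool /=.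
have := le_cool (- G)%game (- H)%game.
by rewrite -game_oppD val_ofD !val_coolN -opprD value_leN2 -val_ofD.
Qed.
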